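(* Let $0<\lambda\le1$, $f\in\mathcal U(\lambda)$ with $f(z)=z+\sum_{k\ge2}a_kz^k$, and suppose $|a_2|=1+\lambda$. Then there is a real $\theta$ such that $f(z)=\dfrac{z}{1-a_2z+\lambda e^{i\theta}z^2}$ for $z\in\mathbb D$; more precisely, there is a real $\phi$ such that $$f(z)=\frac{z}{1-(1+\lambda)e^{i\phi}z+\lambda e^{2i\phi}z^2},\qquad z\in\mathbb D.$$
   Context: $\mathbb D=\{z\in\mathbb C:|z|<1\}$. $\mathcal A$ is the class of functions $f$ analytic in $\mathbb D$ with $f(z)=z+\sum_{k\ge2}a_kz^k$. For $f\in\mathcal A$ with $f(z)\ne0$ for $z\in\mathbb D\setminus\{0\}$, set $U_f(z)=\left(\frac{z}{f(z)}\right)^2f'(z)-1$. For $0<\lambda\le1$, $\mathcal U(\lambda)$ is the class of such $f\in\mathcal A$ with $|U_f(z)|<\lambda$ for all $z\in\mathbb D$. *)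

(* Defs.v *)
From Stdlib Require Import Reals.
From Coquelicot Require Import Coquelicot.
Open Scope C_scope.

Definition inD (z : C) : Prop := (Cmod z < 1)%R.

Definition cis (t : R) : C := (cos t, sin t).

Definition classA (f : C -> C) (a : nat -> C) : Prop :=
  a 0%nat = 0 /\ a 1%nat = 1 /\ forall z, inD z -> is_pseries a z (f z).

Definition U_f (f f' : C -> C) (z : C) : C := (z / f z) ^ 2 * f' z - 1.

(* f in U(lambda): f in A, f(z) <> 0 on D \ {0}, and |U_f(z)| < lambda on D.
   At z = 0, U_f is defined by continuity (U_f(0) = 0), so the bound is
   only imposed for z <> 0 (it holds trivially at 0). *)
Definition classU (lam : R) (f : C -> C) (a : nat -> C) : Prop :=
  classA f a /\
  (forall z, inD z -> z <> 0 -> f z <> 0) /\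
  exists f' : C -> C,
    (forall z, inD z -> is_derive (K := C_AbsRing) f z (f' z)) /\
    (forall z, inD z -> z <> 0 -> (Cmod (U_f f f' z) < lam)%R).

(* Main.v *)
Require Import Defs.
From Stdlib Require Import Reals Lra Lia List Classical IndefiniteDescription.
From Coquelicot Require Import Coquelicot.
Open Scope C_scope.

(** Write [f = z p] and [G = 1/f - 1/z + a2].  Then [G] is holomorphic in the disc, [G 0 = 0] and
    [G' = - U_f / z^2], so the maximum principle gives [|G'| <= lam] and [G] is [lam]-Lipschitz.
    Since [1/p = 1 - a2 z + z G z], a zero of the right-hand side is a fixed point of
    [1 / (a2 - G)].  Replacing [a2] by [(1 + ep) a2] makes this map a contraction, so [|1/p|] takes
    arbitrarily small values.  With [a2 = (1 + lam) e], [|e| = 1], such values can only occur where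
    [z] is near [conj e] and [G z] is near [lam e]; as [G] is [lam]-Lipschitz and vanishes at [0],
    it is then equal to [lam e^2 z] on the radius through [conj e], hence everywhere.

    The maximum principle is obtained without integration: the values of [F] at the four points
    [a + s, a - s, a + i s, a - i s] average to [F a + O(s^3)], so [|F| + ep |z|^2] has no interior
    maximum. *)

(** * Complex power series on the unit disc *)

Definition cseries (u : nat -> C) (l : C) : Prop :=
  is_series (K := C_AbsRing) (V := C_NormedModule) u l.

Definition power_series (c : nat -> C) (S : C -> C) : Prop :=
  forall z, inD z -> cseries (fun k => c k * z ^ k) (S z).

Lemma Cmod_normC (x : C) : Cmod x = norm (K := C_AbsRing) (V := C_NormedModule) x.
Proof. reflexivity. Qed.

Lemma cseries_unique (u : nat -> C) (l m : C) : cseries u l -> cseries u m -> l = m.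
Proof.
  intros H1 H2.
  exact (filterlim_locally_unique (V := C_NormedModule) (sum_n u) l m H1 H2).
Qed.

Lemma cseries_ext (u v : nat -> C) (l : C) :
  (forall n, u n = v n) -> cseries u l -> cseries v l.
Proof. intros H; exact (is_series_ext (V := C_NormedModule) u v l H). Qed.

Lemma cseries_plus (u v : nat -> C) (l m : C) :
  cseries u l -> cseries v m -> cseries (fun k => u k + v k) (l + m).
Proof. exact (is_series_plus (V := C_NormedModule) u v l m). Qed.

Lemma cseries_scal (x : C) (u : nat -> C) (l : C) :
  cseries u l -> cseries (fun k => x * u k) (x * l).
Proof. exact (is_series_scal (V := C_NormedModule) x u l). Qed.

Lemma cseries_tail (u : nat -> C) (l : C) :
  cseries u l -> cseries (fun k => u (S k)) (l - u 0%nat).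
Proof.
  intros H. apply (is_series_incr_1 (V := C_NormedModule) u).
  replace (plus _ _) with l; [exact H|].
  change (l = l - u 0%nat + u 0%nat). ring.
Qed.

Lemma cseries_cons (u : nat -> C) (l : C) :
  cseries (fun k => u (S k)) l -> cseries u (l + u 0%nat).
Proof.
  intros H. apply (is_series_decr_1 (V := C_NormedModule) u).
  replace (plus _ _) with l; [exact H|].
  change (l = l + u 0%nat + - u 0%nat). ring.
Qed.

Lemma eventually_bounded (u : nat -> R) (N : nat) (M : R) :
  (forall n, (N <= n)%nat -> (u n <= M)%R) -> exists M', forall n, (u n <= M')%R.
Proof.
  revert M; induction N as [|N IH]; intros M H.
  - exists M; intros n; apply H; lia.
  - apply (IH (Rmax M (u N))). intros n Hn.
    destruct (Nat.eq_dec n N) as [->|Hne]; [apply Rmax_r|].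
    eapply Rle_trans; [apply H; lia|apply Rmax_l].
Qed.

(** Cauchy's criterion, applied to blocks of a single term, bounds all terms beyond some rank by 1;
    only finitely many remain. *)
Lemma cseries_bounded (u : nat -> C) (l : C) :
  cseries u l -> exists M, forall n, (Cmod (u n) <= M)%R.
Proof.
  intros H.
  destruct (Cauchy_ex_series (V := C_CompleteNormedModule) u
              (ex_intro _ l H) (mkposreal 1 Rlt_0_1)) as [N HN].
  apply (eventually_bounded (fun n => Cmod (u n)) N 1).
  intros n Hn. specialize (HN n n Hn Hn).
  rewrite sum_n_n in HN. rewrite Cmod_normC. apply Rlt_le. exact HN.
Qed.

Lemma inD_between (z : C) : inD z -> exists r, (0 < r < 1)%R /\ (Cmod z < r)%R.
Proof.
  unfold inD; intros H. exists ((1 + Cmod z) / 2)%R.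
  generalize (Cmod_ge_0 z); lra.
Qed.

Lemma Cmod_RtoC_pos (r : R) : (0 <= r)%R -> Cmod r = r.
Proof. intros H; rewrite Cmod_R; apply Rabs_pos_eq, H. Qed.

(** By Cauchy-Hadamard this says that the radius of convergence is at least 1. Being a condition on
    coefficients alone, it passes to shifted and differentiated series, whose sums
    [subexp_power_series] then supplies. *)
Definition subexp (c : nat -> C) : Prop :=
  forall r, (0 < r < 1)%R -> exists M, forall n, (Cmod (c n) * r ^ n <= M)%R.

Lemma power_series_subexp c S : power_series c S -> subexp c.
Proof.
  intros H r Hr.
  destruct (cseries_bounded _ _ (H (RtoC r) ltac:(unfold inD; rewrite Cmod_RtoC_pos; lra)))
    as [M HM].
  exists M; intros n. specialize (HM n).
  rewrite Cmod_mult, Cmod_pow, Cmod_RtoC_pos in HM by lra. exact HM.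
Qed.

Lemma geometric_domination (c : nat -> C) (r M : R) (z : C) :
  (0 < r)%R -> (forall n, Cmod (c n) * r ^ n <= M)%R ->
  forall n, (Cmod (c n * z ^ n) <= M * (Cmod z / r) ^ n)%R.
Proof.
  intros Hr HM n.
  rewrite Cmod_mult, Cmod_pow. unfold Rdiv. rewrite Rpow_mult_distr.
  rewrite pow_inv.
  assert (Hp : (0 < r ^ n)%R) by (apply pow_lt; lra).
  replace (Cmod (c n) * Cmod z ^ n)%R
    with ((Cmod (c n) * r ^ n) * (Cmod z ^ n * / r ^ n))%R by (field; lra).
  apply Rmult_le_compat_r; [|apply HM].
  apply Rmult_le_pos; [apply pow_le, Cmod_ge_0 | left; apply Rinv_0_lt_compat, Hp].
Qed.

Lemma ratio_range (z : C) (r : R) : (0 < r)%R -> (Cmod z < r)%R ->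
  (0 <= Cmod z / r < 1)%R.
Proof.
  intros Hr Hz; split.
  - apply Rmult_le_pos; [apply Cmod_ge_0|left; apply Rinv_0_lt_compat, Hr].
  - apply Rmult_lt_reg_r with r; [exact Hr|].
    unfold Rdiv; rewrite Rmult_assoc, Rinv_l, Rmult_1_r by lra; lra.
Qed.

(** Comparison with a geometric series of ratio [|z| / r]. The explicit bound on the sum later gives
    bounds uniform in [z] and the growth of the coefficients of a quotient. *)
Lemma geometric_cseries (c : nat -> C) (r M : R) (z : C) :
  (0 < r)%R -> (forall n, Cmod (c n) * r ^ n <= M)%R -> (Cmod z < r)%R ->
  exists l, cseries (fun n => c n * z ^ n) l /\ (Cmod l <= M / (1 - Cmod z / r))%R.
Proof.
  intros Hr HM Hz.
  pose proof (geometric_domination c r M z Hr HM) as Hdom.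
  destruct (ratio_range z r Hr Hz) as [Hq0 Hq1].
  set (q := (Cmod z / r)%R) in *.
  assert (Hgeom : is_series (fun n => M * q ^ n)%R (M / (1 - q))%R).
  { apply (is_series_scal (V := R_NormedModule) M (fun n => q ^ n)%R (/ (1 - q))%R).
    apply is_series_geom. rewrite Rabs_pos_eq; lra. }
  destruct (ex_series_le (V := C_CompleteNormedModule) (fun n => c n * z ^ n)
     (fun n => M * q ^ n)%R) as [l Hl].
  { intros n. exact (Hdom n). }
  { eexists; exact Hgeom. }
  exists l; split; [exact Hl|].
  change (is_lim_seq (sum_n (fun n => M * q ^ n)%R) (M / (1 - q))%R) in Hgeom.
  refine (is_lim_seq_le (fun n => Cmod (sum_n (fun n => c n * z ^ n) n)) _
            (Cmod l) _ _ _ Hgeom).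
  - intros n. rewrite Cmod_normC.
    eapply Rle_trans; [apply (norm_sum_n_m (V := C_NormedModule))|].
    apply sum_n_m_le. intros k. exact (Hdom k).
  - rewrite Cmod_normC.
    apply (is_lim_seq_ext (fun n => norm (sum_n (fun n => c n * z ^ n) n : C_NormedModule))).
    { intros n; reflexivity. }
    exact (filterlim_comp _ _ _ _ _ _ _ _ Hl (filterlim_norm (V := C_NormedModule) l)).
Qed.

Lemma subexp_power_series c : subexp c -> exists S, power_series c S.
Proof.
  intros H.
  assert (Hex : forall z, exists l, inD z -> cseries (fun k => c k * z ^ k) l).
  { intros z. destruct (classic (inD z)) as [Hz|Hz].
    - destruct (inD_between z Hz) as (r & Hr & Hzr).
      destruct (H r Hr) as [M HM].
      destruct (geometric_cseries c r M z ltac:(lra) HM Hzr) as (l & Hl & _).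
      exists l; auto.
    (* Outside the disc the requirement is vacuous, and 0 is a default value. *)
    - exists 0; tauto. }
  destruct (functional_choice _ Hex) as [S HS]. exists S; intros z Hz; apply HS, Hz.
Qed.

Lemma power_series_bounded c S r : power_series c S -> (0 <= r < 1)%R ->
  exists M, forall z, (Cmod z <= r)%R -> (Cmod (S z) <= M)%R.
Proof.
  intros H Hr.
  assert (Hr' : (0 < (1 + r) / 2 < 1)%R) by lra.
  destruct (power_series_subexp _ _ H _ Hr') as [M HM].
  exists (M / (1 - r / ((1 + r) / 2)))%R; intros z Hz.
  set (r' := ((1 + r) / 2)%R) in *.
  assert (Hrr : (r < r')%R) by (unfold r'; lra).
  destruct (geometric_cseries c r' M z ltac:(lra) HM ltac:(lra)) as (l & Hl & Hb).
  rewrite (cseries_unique _ _ _ (H z ltac:(unfold inD; lra)) Hl).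
  eapply Rle_trans; [exact Hb|].
  assert (HM0 : (0 <= M)%R).
  { eapply Rle_trans; [|apply (HM 0%nat)]. simpl; rewrite Rmult_1_r; apply Cmod_ge_0. }
  apply Rmult_le_compat_l; [exact HM0|].
  assert (Hi : (0 < / r')%R) by (apply Rinv_0_lt_compat; lra).
  assert (Cmod z / r' <= r / r')%R by (apply Rmult_le_compat_r; lra).
  assert (r / r' < 1)%R.
  { apply Rmult_lt_reg_r with r'; [lra|].
    unfold Rdiv; rewrite Rmult_assoc, Rinv_l; lra. }
  apply Rinv_le_contravar; lra.
Qed.

(** Each of the [n] terms of [1 + x + ... + x^(n-1)] is at least [x^n], and this sum times [1 - x]
    is [1 - x^n]. The induction proves the bound in this multiplied form. *)
Lemma INR_pow_bound (x : R) (n : nat) : (0 <= x < 1)%R -> (INR n * x ^ n <= / (1 - x))%R.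
Proof.
  intros Hx.
  assert (H : (INR n * x ^ n * (1 - x) <= 1 - x ^ n)%R).
  { induction n as [|n IH]; [simpl; lra|].
    rewrite S_INR; simpl.
    assert (Hp : (0 <= x ^ n <= 1)%R).
    { split; [apply pow_le; lra|]. rewrite <- (pow1 n). apply pow_incr; lra. }
    apply Rmult_le_compat_l with (r := x) in IH; [|lra].
    assert (0 <= (1 - x) * (1 - x * x ^ n))%R by (apply Rmult_le_pos; nra).
    lra. }
  assert (Hp : (0 <= x ^ n)%R) by (apply pow_le; lra).
  apply Rmult_le_reg_r with (1 - x)%R; [lra|].
  rewrite Rinv_l by lra. lra.
Qed.

(** The factor [n] is absorbed by the gap between [r] and the larger radius [s = (1 + r) / 2]. *)
Lemma subexp_INR (c : nat -> C) : subexp c -> subexp (fun n => RtoC (INR n) * c n).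
Proof.
  intros H r Hr.
  assert (Hr' : (0 < (1 + r) / 2 < 1)%R) by lra.
  destruct (H _ Hr') as [M HM]. set (s := ((1 + r) / 2)%R) in *.
  assert (Hq : (0 <= r / s < 1)%R).
  { assert (Hi : (0 < / s)%R) by (apply Rinv_0_lt_compat; lra).
    assert (Hs : (s * / s = 1)%R) by (apply Rinv_r; lra).
    assert (r < s)%R by (unfold s; lra).
    unfold Rdiv; split; nra. }
  assert (HM0 : (0 <= M)%R).
  { eapply Rle_trans; [|apply (HM 0%nat)]. simpl; rewrite Rmult_1_r; apply Cmod_ge_0. }
  exists (M * / (1 - r / s))%R; intros n.
  rewrite Cmod_mult, Cmod_RtoC_pos by apply pos_INR.
  replace (INR n * Cmod (c n) * r ^ n)%R
    with ((Cmod (c n) * s ^ n) * (INR n * (r / s) ^ n))%R.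
  2: { unfold Rdiv; rewrite Rpow_mult_distr, pow_inv. field. apply pow_nonzero; lra. }
  apply Rmult_le_compat; [| |apply HM|apply INR_pow_bound, Hq].
  - apply Rmult_le_pos; [apply Cmod_ge_0|apply pow_le; lra].
  - apply Rmult_le_pos; [apply pos_INR|apply pow_le; lra].
Qed.

Lemma subexp_shift (c : nat -> C) : subexp c -> subexp (fun n => c (S n)).
Proof.
  intros H r Hr. destruct (H r Hr) as [M HM].
  exists (M / r)%R; intros n. specialize (HM (S n)); simpl in HM.
  apply Rmult_le_reg_r with r; [lra|].
  unfold Rdiv; rewrite (Rmult_assoc M), Rinv_l by lra. lra.
Qed.

(* The coefficients [d j] of the quotient are the sums [c (j+1) + c (j+2) a + ...]. *)
Lemma power_series_divide c S a : power_series c S -> inD a ->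
  exists d T, power_series d T /\
    (forall j, c (Datatypes.S j) = d j - a * d (Datatypes.S j)) /\
    (forall z, inD z -> S z = S a + (z - a) * T z).
Proof.
  intros HS Ha.
  pose proof (power_series_subexp _ _ HS) as Hc.
  assert (Hsub : forall n, subexp (fun k => c (n + k)%nat)).
  { induction n as [|n IH]; [exact Hc|].
    intros r Hr. destruct (subexp_shift _ IH r Hr) as [M HM].
    exists M; intros k. specialize (HM k). rewrite Nat.add_succ_r in HM. exact HM. }
  assert (Hex : forall n, exists l, cseries (fun k => c (n + k)%nat * a ^ k) l).
  { intros n. destruct (subexp_power_series _ (Hsub n)) as [F HF].
    exists (F a); apply HF, Ha. }
  destruct (functional_choice _ Hex) as [e He].
  assert (Hrec : forall n, e n = a * e (Datatypes.S n) + c n).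
  { intros n. eapply cseries_unique; [apply He|].
    replace (c n) with (c (n + 0)%nat * a ^ 0)
      by (rewrite Nat.add_0_r; simpl; ring).
    apply (cseries_cons (fun k => c (n + k)%nat * a ^ k)).
    eapply cseries_ext; [|apply cseries_scal, He].
    intros k; simpl. rewrite Nat.add_succ_r. ring. }
  assert (HSa : S a = e 0%nat).
  { eapply cseries_unique; [apply HS, Ha|apply (He 0%nat)]. }
  assert (Hd : subexp (fun j => e (Datatypes.S j))).
  { apply subexp_shift. intros r Hr.
    (* The radius [s] exceeds [|a|], so that the series for [e n] is dominated by a geometric one,
       and is at least [r], so that the resulting factor [1 / s^n] offsets the weight [r^n]. *)
    assert (exists s, (Cmod a < s /\ r <= s /\ s < 1)%R) as (s & Has & Hrs & Hs1).
    { exists (Rmax ((1 + Cmod a) / 2) r). unfold inD in Ha.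
      generalize (Rmax_l ((1 + Cmod a) / 2) r) (Rmax_r ((1 + Cmod a) / 2) r).
      split; [lra|split; [lra|]]. apply Rmax_lub_lt; lra. }
    destruct (Hc s ltac:(lra)) as [M HM].
    exists (M / (1 - Cmod a / s))%R. intros n.
    assert (Hsn : (0 < s ^ n)%R) by (apply pow_lt; lra).
    destruct (geometric_cseries (fun k => c (n + k)%nat) s (M / s ^ n)%R a) as (l & Hl & Hb);
      [lra| |exact Has|].
    { intros k. specialize (HM (n + k)%nat). rewrite pow_add in HM.
      apply Rmult_le_reg_r with (s ^ n)%R; [exact Hsn|].
      unfold Rdiv; rewrite (Rmult_assoc M), Rinv_l by lra. lra. }
    rewrite (cseries_unique _ _ _ (He n) Hl).
    apply Rle_trans with (Cmod l * s ^ n)%R.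
    { apply Rmult_le_compat_l; [apply Cmod_ge_0|]. apply pow_incr; lra. }
    apply Rmult_le_compat_r with (r := (s ^ n)%R) in Hb; [|lra].
    eapply Rle_trans; [exact Hb|]. right. field.
    pose proof (ratio_range a s ltac:(lra) Has) as Hq.
    repeat split; lra. }
  destruct (subexp_power_series _ Hd) as [T HT].
  exists (fun j => e (Datatypes.S j)), T. split; [exact HT|split].
  - intros j. rewrite (Hrec (Datatypes.S j)). ring.
  - intros z Hz. rewrite HSa.
    pose proof (HT z Hz) as Hz1.
    pose proof (cseries_tail _ _ Hz1) as Hz2.
    (* With [d j = e (j+1)], the recurrence splits the series without its constant term into [z T z]
       and [- a (T z - d 0)]. *)
    assert (Hz3 : cseries (fun k => c (Datatypes.S k) * z ^ Datatypes.S k)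
                    (z * T z + - a * (T z - e 1%nat * z ^ 0))).
    { eapply cseries_ext; [|apply cseries_plus; apply cseries_scal; [exact Hz1|exact Hz2]].
      intros k; simpl. rewrite (Hrec (Datatypes.S k)). ring. }
    rewrite (cseries_unique _ _ _ (HS z Hz) (cseries_cons (fun k => c k * z ^ k) _ Hz3)).
    rewrite (Hrec 0%nat). simpl. ring.
Qed.

Lemma cseries_term_lim (u : nat -> C) (l : C) : cseries u l ->
  filterlim (fun n => u (S n)) eventually (locally (T := C_NormedModule) (RtoC 0)).
Proof.
  intros H.
  assert (HS : filterlim (fun n => sum_n (G := C_NormedModule) u (S n)) eventually
                 (locally (T := C_NormedModule) l)).
  { exact (filterlim_comp _ _ _ S _ _ _ _ (eventually_subseq S ltac:(intros; lia)) H). }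
  replace (locally (T := C_NormedModule) (RtoC 0))
    with (locally (T := C_NormedModule) (plus l (opp l : C_NormedModule)))
    by (f_equal; change (l + - l = 0); ring).
  apply (filterlim_ext (fun n => plus (sum_n (G := C_NormedModule) u (S n))
                               (opp (sum_n (G := C_NormedModule) u n)))).
  { intros n. rewrite sum_Sn.
    change (sum_n (G := C_NormedModule) u n + u (S n) + - sum_n (G := C_NormedModule) u n = u (S n)).
    ring. }
  eapply filterlim_comp_2; [exact HS| |apply (filterlim_plus (V := C_NormedModule) l (opp l))].
  eapply filterlim_comp; [exact H|apply (filterlim_opp (V := C_NormedModule) l)].
Qed.

(* Abel summation with [c (j+1) = d j - a d (j+1)]; the boundary term tends to 0. *)
Lemma power_series_deriv c S : power_series c S ->
  exists S', power_series (fun k => RtoC (INR (k + 1)) * c (k + 1)%nat) S' /\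
    forall a, inD a -> exists d T, power_series d T /\ T a = S' a /\
      forall z, inD z -> S z = S a + (z - a) * T z.
Proof.
  intros HS.
  assert (Hex : forall a, exists l, inD a -> exists d T, power_series d T /\ T a = l /\
      (forall z, inD z -> S z = S a + (z - a) * T z) /\
      cseries (fun k => RtoC (INR (k + 1)) * c (k + 1)%nat * a ^ k) l).
  { intros a. destruct (classic (inD a)) as [Ha|Ha]; [|exists 0; tauto].
    destruct (power_series_divide c S a HS Ha) as (d & T & HT & Hrec & Hdiv).
    exists (T a); intros _. exists d, T. repeat split; [exact HT|exact Hdiv|].
    (* The boundary term at stage [n] is [(n+1) d (n+1) a^(n+1)], a term of the convergent series
       with coefficients [n d n]; hence it tends to 0. *)
    destruct (subexp_power_series _ (subexp_INR _ (power_series_subexp _ _ HT))) as [E HE].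
    pose proof (cseries_term_lim _ _ (HE a Ha)) as Hlim.
    pose proof (HT a Ha) as HTa.
    unfold cseries, is_series in *.
    replace (locally (T := C_NormedModule) (T a))
      with (locally (T := C_NormedModule) (plus (T a) (opp (RtoC 0 : C_NormedModule)))).
    2: { f_equal. change (T a + - 0 = T a). ring. }
    eapply filterlim_ext;
      [|eapply filterlim_comp_2; [exact HTa| |apply (filterlim_plus (V := C_NormedModule))];
        eapply filterlim_comp; [exact Hlim|apply (filterlim_opp (V := C_NormedModule) (RtoC 0))]].
    intros n. cbv beta. induction n as [|n IH].
    - rewrite !sum_O.
      change (d 0%nat * a ^ 0 + - (RtoC 1 * d 1%nat * a ^ 1) = RtoC 1 * c 1%nat * a ^ 0).
      rewrite (Hrec 0%nat). simpl; ring.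
    - rewrite !sum_Sn, <- IH.
      replace (Datatypes.S n + 1)%nat with (Datatypes.S (Datatypes.S n)) by lia.
      rewrite (Hrec (Datatypes.S n)).
      rewrite (S_INR (Datatypes.S n)), RtoC_plus.
      change plus with Cplus; change opp with Copp; simpl Cpow.
      match goal with |- @eq _ ?x ?y => change (@eq C x y) end. ring. }
  destruct (functional_choice _ Hex) as [S' HS']. exists S'; split.
  - intros a Ha. destruct (HS' a Ha) as (d & T & _ & _ & _ & H). exact H.
  - intros a Ha. destruct (HS' a Ha) as (d & T & H1 & H2 & H3 & _).
    exists d, T; auto.
Qed.

(** Letting [t] tend to 0 along the radius kills the constant coefficient. The shifted series then
    vanishes on the same radius, and induction reaches every coefficient. *)
Lemma power_series_identity c S (u : C) : power_series c S -> Cmod u = 1%R ->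
  (forall t, (0 < t < 1)%R -> S (RtoC t * u) = 0) -> forall n, c n = 0.
Proof.
  intros HS Hu H0.
  assert (Hmod : forall t, (0 < t < 1)%R -> Cmod (RtoC t * u) = t).
  { intros t Ht. rewrite Cmod_mult, Hu, Cmod_RtoC_pos by lra. ring. }
  assert (Hhead : forall c S, power_series c S ->
    (forall t, (0 < t < 1)%R -> S (RtoC t * u) = 0) -> c 0%nat = 0 /\
    exists S1, power_series (fun n => c (Datatypes.S n)) S1 /\
    (forall t, (0 < t < 1)%R -> S1 (RtoC t * u) = 0)).
  { clear c S HS H0. intros c S HS H0.
    destruct (subexp_power_series _ (subexp_shift _ (power_series_subexp _ _ HS))) as [S1 HS1].
    assert (Hrel : forall z, inD z -> S z = z * S1 z + c 0%nat).
    { intros z Hz. eapply cseries_unique; [apply HS, Hz|].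
      replace (c 0%nat) with (c 0%nat * z ^ 0) by (simpl; ring).
      apply (cseries_cons (fun k => c k * z ^ k)).
      eapply cseries_ext; [|apply cseries_scal, (HS1 z Hz)]. intros k; simpl; ring. }
    assert (Hc : c 0%nat = 0).
    { apply Cmod_eq_0, Rle_antisym; [|apply Cmod_ge_0].
      destruct (power_series_bounded _ _ (1/2) HS1 ltac:(lra)) as [M HM].
      assert (HM0 : (0 <= M)%R).
      { eapply Rle_trans; [apply Cmod_ge_0|apply (HM 0); rewrite Cmod_0; lra]. }
      apply le_epsilon; intros eps Heps. rewrite Rplus_0_l.
      set (t := Rmin (1/2) (eps / (M + 1))).
      assert (Ht : (0 < t <= 1/2)%R).
      { split; [apply Rmin_glb_lt; [lra|apply Rdiv_lt_0_compat; lra]|apply Rmin_l]. }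
      assert (Ht2 : (t * (M + 1) <= eps)%R).
      { apply Rle_trans with (eps / (M + 1) * (M + 1))%R;
          [apply Rmult_le_compat_r; [lra|apply Rmin_r]|right; field; lra]. }
      pose proof (Hmod t ltac:(lra)) as Hmt.
      pose proof (Hrel (RtoC t * u) ltac:(unfold inD; lra)) as Heq.
      rewrite H0 in Heq by lra.
      replace (c 0%nat) with (- (RtoC t * u * S1 (RtoC t * u))).
      2: { rewrite <- (Cplus_0_l (- _)), Heq. ring. }
      rewrite Cmod_opp, Cmod_mult, Hmt.
      pose proof (HM (RtoC t * u) ltac:(lra)) as Hb. nra. }
    split; [exact Hc|]. exists S1; split; [exact HS1|].
    intros t Ht. pose proof (Hrel (RtoC t * u) ltac:(unfold inD; rewrite Hmod; lra)) as Heq.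
    rewrite (H0 t Ht), Hc, Cplus_0_r in Heq.
    assert (Hnz : RtoC t * u <> 0) by (apply Cmod_gt_0; rewrite Hmod; lra).
    destruct (Ceq_dec (S1 (RtoC t * u)) 0) as [E|E]; [exact E|].
    destruct (Cmult_neq_0 _ _ Hnz E). auto. }
  intros n; revert c S HS H0; induction n as [|n IH]; intros c S HS H0;
    destruct (Hhead c S HS H0) as (Hc & S1 & HS1 & H1); [exact Hc|].
  exact (IH _ S1 HS1 H1).
Qed.

(** * Taylor jets and derivatives *)

Definition near (a : C) (P : C -> Prop) : Prop :=
  exists d, (0 < d)%R /\ forall z, (Cmod (z - a) < d)%R -> P z.

Lemma near_at a P : near a P -> P a.
Proof.
  intros (d & Hd & H). apply H.
  replace (a - a) with (RtoC 0) by ring. rewrite Cmod_0; exact Hd.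
Qed.

Lemma near_and a (P Q : C -> Prop) : near a P -> near a Q -> near a (fun z => P z /\ Q z).
Proof.
  intros (d & Hd & HP) (e & He & HQ). exists (Rmin d e); split.
  - apply Rmin_glb_lt; assumption.
  - intros z Hz; split; [apply HP|apply HQ]; (eapply Rlt_le_trans; [exact Hz|]);
      [apply Rmin_l|apply Rmin_r].
Qed.

Lemma near_imp a (P Q : C -> Prop) : (forall z, P z -> Q z) -> near a P -> near a Q.
Proof. intros H (d & Hd & HP). exists d; split; auto. Qed.

Lemma near_all a (P : C -> Prop) : (forall z, P z) -> near a P.
Proof. intros H. exists 1%R; split; [lra|auto]. Qed.

Lemma near_ball a e : (0 < e)%R -> near a (fun z => (Cmod (z - a) < e)%R).
Proof. intros He; exists e; auto. Qed.

Lemma Cmod_le_add (x y : C) : (Cmod x <= Cmod y + Cmod (x - y))%R.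
Proof.
  replace x with (y + (x - y)) at 1 by ring. apply Cmod_triangle.
Qed.

Lemma near_Cmod_lt a r : (Cmod a < r)%R -> near a (fun z => (Cmod z < r)%R).
Proof.
  intros H. eapply near_imp; [|apply (near_ball a (r - Cmod a)); lra].
  intros z Hz. cbv beta in Hz. pose proof (Cmod_le_add z a). lra.
Qed.

Lemma near_inD a : inD a -> near a inD.
Proof. exact (near_Cmod_lt a 1). Qed.

(* [jet n a F]: an [n]-fold Caratheodory factorization of [F] at [a], that is
   [F z = c0 + c1 (z-a) + ... + O((z-a)^n)]. *)
Fixpoint jet (n : nat) (a : C) (F : C -> C) : Prop :=
  match n with
  | O => exists M, near a (fun z => (Cmod (F z) <= M)%R)
  | S m => exists K, jet m a K /\ near a (fun z => F z = F a + (z - a) * K z)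
  end.

Definition smooth (a : C) (F : C -> C) : Prop := forall n, jet n a F.

Lemma jet_pred n a F : jet (S n) a F -> jet n a F.
Proof.
  revert F; induction n as [|n IH]; intros F (K & HK & HF).
  - destruct HK as [M HM]. exists (Cmod (F a) + M)%R.
    eapply near_imp; [|apply (near_and _ _ _ HF (near_and _ _ _ HM (near_ball a 1 Rlt_0_1)))].
    intros z (-> & Hb & Hz).
    eapply Rle_trans; [apply Cmod_triangle|]. apply Rplus_le_compat_l.
    rewrite Cmod_mult. generalize (Cmod_ge_0 (z - a)) (Cmod_ge_0 (K z)); intros; nra.
  - exists K; split; [apply IH, HK|exact HF].
Qed.

Lemma jet_le m n a F : (m <= n)%nat -> jet n a F -> jet m a F.
Proof. induction 1; intros H1; [exact H1|apply IHle, jet_pred, H1]. Qed.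

Lemma jet_const n a c : jet n a (fun _ => c).
Proof.
  revert c; induction n as [|n IH]; intros c.
  - exists (Cmod c). apply near_all; intros _; apply Rle_refl.
  - exists (fun _ => 0); split; [apply IH|apply near_all; intros z; ring].
Qed.

Lemma jet_id n a : jet n a (fun z => z).
Proof.
  apply (jet_le n (S n)); [lia|]. exists (fun _ => 1).
  split; [apply jet_const|apply near_all; intros z; ring].
Qed.

Lemma jet_plus n a F G : jet n a F -> jet n a G -> jet n a (fun z => F z + G z).
Proof.
  revert F G; induction n as [|n IH]; intros F G.
  - intros [M HM] [N HN]. exists (M + N)%R.
    eapply near_imp; [|apply (near_and _ _ _ HM HN)].
    intros z [H1 H2]. eapply Rle_trans; [apply Cmod_triangle|lra].
  - intros (K & HK & HF) (L & HL & HG). exists (fun z => K z + L z); split; [apply IH; assumption|].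
    eapply near_imp; [|apply (near_and _ _ _ HF HG)].
    intros z [-> ->]; ring.
Qed.

(** The slope of the product is [K G + F(a) L]. It contains [G] itself, so the jet of [G] is first
    lowered by one order. *)
Lemma jet_mult n a F G : jet n a F -> jet n a G -> jet n a (fun z => F z * G z).
Proof.
  revert F G; induction n as [|n IH]; intros F G.
  - intros [M HM] [N HN]. exists (M * N)%R.
    eapply near_imp; [|apply (near_and _ _ _ HM HN)].
    intros z [H1 H2]. rewrite Cmod_mult.
    apply Rmult_le_compat; auto using Cmod_ge_0.
  - intros HF HG. pose proof (jet_pred _ _ _ HG) as HG'.
    destruct HF as (K & HK & HF), HG as (L & HL & HG).
    exists (fun z => K z * G z + F a * L z); split.
    + apply jet_plus; apply IH; auto using jet_const.
    + eapply near_imp; [|apply (near_and _ _ _ HF HG)].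
      intros z [-> H]. rewrite H; ring.
Qed.

Lemma jet1_continuous a F : jet 1 a F -> forall e, (0 < e)%R ->
  near a (fun z => (Cmod (F z - F a) < e)%R).
Proof.
  intros (K & [M HM] & HF) e He.
  assert (HM0 : (0 <= M)%R).
  { eapply Rle_trans; [apply Cmod_ge_0|apply (near_at _ _ HM)]. }
  eapply near_imp; [|apply (near_and _ _ _ HF (near_and _ _ _ HM
     (near_ball a (e / (M + 1)) ltac:(apply Rdiv_lt_0_compat; lra))))].
  intros z (-> & Hb & Hz).
  replace (F a + (z - a) * K z - F a) with ((z - a) * K z) by ring.
  rewrite Cmod_mult.
  apply Rmult_lt_compat_r with (r := (M + 1)%R) in Hz; [|lra].
  replace (e / (M + 1) * (M + 1))%R with e in Hz by (field; lra).
  generalize (Cmod_ge_0 (z - a)) (Cmod_ge_0 (K z)); intros; nra.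
Qed.

Lemma jet1_lower_bound a (F : C -> C) : jet 1 a F -> F a <> 0 ->
  near a (fun z => (Cmod (F a) / 2 <= Cmod (F z))%R).
Proof.
  intros HF Ha. apply Cmod_gt_0 in Ha.
  eapply near_imp; [|apply (jet1_continuous a F HF (Cmod (F a) / 2)); lra].
  intros z Hz. cbv beta in Hz. pose proof (Cmod_le_add (F a) (F z)) as H.
  replace (F a - F z) with (- (F z - F a)) in H by ring.
  rewrite Cmod_opp in H. lra.
Qed.

Lemma inv_factor (x y h k : C) : x <> 0 -> y <> 0 -> y = x + h * k ->
  / y = / x + h * (- k * (/ x * / y)).
Proof.
  intros Hx Hy E.
  assert (Hhk : h * k = y - x) by (rewrite E; ring).
  transitivity (/ x - (h * k) * (/ x * / y)); [|ring].
  rewrite Hhk. field; auto.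
Qed.

Lemma near_nonzero a (F : C -> C) : jet 1 a F -> F a <> 0 -> near a (fun z => F z <> 0).
Proof.
  intros HF Ha. eapply near_imp; [|apply (jet1_lower_bound a F HF Ha)].
  intros z Hz. cbv beta in Hz. apply Cmod_gt_0. apply Cmod_gt_0 in Ha. lra.
Qed.

(** One order is lost: bounding [1 / F] near [a] requires continuity of [F] there, which a jet of
    order 1 provides and a mere bound does not. *)
Lemma jet_inv n a (F : C -> C) : F a <> 0 -> jet (S n) a F -> jet n a (fun z => / F z).
Proof.
  intros Ha; induction n as [|n IH]; intros HF.
  - pose proof (jet1_lower_bound a F HF Ha) as Hlow.
    pose proof (near_nonzero a F HF Ha) as Hnz. apply Cmod_gt_0 in Ha.
    exists (/ (Cmod (F a) / 2))%R.
    eapply near_imp; [|apply (near_and _ _ _ Hlow Hnz)].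
    intros z [Hz Hz0]. rewrite Cmod_inv by exact Hz0. apply Rinv_le_contravar; lra.
  - pose proof (near_nonzero a F (jet_le 1 (S (S n)) a F ltac:(lia) HF) Ha) as Hnz.
    pose proof (IH (jet_pred _ _ _ HF)) as HI.
    destruct HF as (K & HK & HF).
    exists (fun z => (- (1) * K z) * (/ F a * / F z)); split.
    + apply jet_mult; apply jet_mult; auto using jet_const, jet_pred.
    + eapply near_imp; [|apply (near_and _ _ _ HF Hnz)].
      intros z [Hz Hz0]. etransitivity; [exact (inv_factor _ _ _ _ Ha Hz0 Hz)|ring].
Qed.

(** Dividing out [z - a] leaves a power series on the same disc, so the factorization can be
    repeated indefinitely. *)
Lemma smooth_power_series c S a : power_series c S -> inD a -> smooth a S.
Proof.
  intros HS Ha n; revert c S HS; induction n as [|n IH]; intros c S HS.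
  - destruct (inD_between a Ha) as (r & Hr & Har).
    destruct (power_series_bounded c S r HS ltac:(lra)) as [M HM].
    exists M. eapply near_imp; [|apply (near_Cmod_lt a r Har)].
    intros z Hz. cbv beta in Hz. apply HM; lra.
  - destruct (power_series_divide c S a HS Ha) as (d & T & HT & _ & H).
    exists T; split; [apply (IH _ _ HT)|].
    eapply near_imp; [|apply (near_inD a Ha)]. exact H.
Qed.

Lemma smooth_const a c : smooth a (fun _ => c).
Proof. intros n; apply jet_const. Qed.
Lemma smooth_id a : smooth a (fun z => z).
Proof. intros n; apply jet_id. Qed.
Lemma smooth_plus a F G : smooth a F -> smooth a G -> smooth a (fun z => F z + G z).
Proof. intros HF HG n; apply jet_plus; auto. Qed.
Lemma smooth_mult a F G : smooth a F -> smooth a G -> smooth a (fun z => F z * G z).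
Proof. intros HF HG n; apply jet_mult; auto. Qed.
Lemma smooth_inv a (F : C -> C) : F a <> 0 -> smooth a F -> smooth a (fun z => / F z).
Proof. intros Ha HF n; apply jet_inv; auto. Qed.

(** Caratheodory's form of the derivative, with a slope [K] that can itself be factored once at [a].
    The calculus rules become identities between slopes, and the continuity of [K] gives the usual
    first-order approximation. *)
Definition has_deriv (F : C -> C) (a l : C) : Prop :=
  exists K, jet 1 a K /\ near a (fun z => F z = F a + (z - a) * K z) /\ K a = l.

Lemma has_deriv_jet F a l : has_deriv F a l -> jet 2 a F.
Proof. intros (K & HK & HF & _); exists K; auto. Qed.

Lemma has_deriv_value F a l m : l = m -> has_deriv F a l -> has_deriv F a m.
Proof. intros ->; auto. Qed.

Lemma has_deriv_ext F G a l :
  near a (fun z => F z = G z) -> has_deriv F a l -> has_deriv G a l.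
Proof.
  intros He (K & HK & HF & Hl). exists K; split; [exact HK|split; [|exact Hl]].
  pose proof (near_at _ _ He) as Ha; cbv beta in Ha.
  eapply near_imp; [|apply (near_and _ _ _ He HF)].
  intros z [<- Hz]. rewrite <- Ha. exact Hz.
Qed.

Lemma has_deriv_const a c : has_deriv (fun _ => c) a 0.
Proof.
  exists (fun _ => 0); split; [apply jet_const|split; [|reflexivity]].
  apply near_all; intros z; ring.
Qed.

Lemma has_deriv_id a : has_deriv (fun z => z) a 1.
Proof.
  exists (fun _ => 1); split; [apply jet_const|split; [|reflexivity]].
  apply near_all; intros z; ring.
Qed.

Lemma has_deriv_plus F G a l m : has_deriv F a l -> has_deriv G a m ->
  has_deriv (fun z => F z + G z) a (l + m).
Proof.
  intros (K & HK & HF & <-) (L & HL & HG & <-).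
  exists (fun z => K z + L z); split; [apply jet_plus; assumption|split; [|reflexivity]].
  eapply near_imp; [|apply (near_and _ _ _ HF HG)].
  intros z [-> ->]; ring.
Qed.

Lemma has_deriv_mult F G a l m : has_deriv F a l -> has_deriv G a m ->
  has_deriv (fun z => F z * G z) a (l * G a + F a * m).
Proof.
  intros (K & HK & HF & <-) HGm.
  pose proof (jet_pred _ _ _ (has_deriv_jet _ _ _ HGm)) as HG1.
  destruct HGm as (L & HL & HG & <-).
  exists (fun z => K z * G z + F a * L z); split; [|split; [|reflexivity]].
  - apply jet_plus; apply jet_mult; auto using jet_const.
  - eapply near_imp; [|apply (near_and _ _ _ HF HG)].
    intros z [-> H]. rewrite H; ring.
Qed.

Lemma has_deriv_inv (F : C -> C) a l : F a <> 0 -> has_deriv F a l ->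
  has_deriv (fun z => / F z) a (- l * (/ F a * / F a)).
Proof.
  intros Ha HFl. pose proof (has_deriv_jet _ _ _ HFl) as HF2.
  pose proof (near_nonzero a F (jet_pred _ _ _ HF2) Ha) as Hnz.
  destruct HFl as (K & HK & HF & <-).
  exists (fun z => (- (1) * K z) * (/ F a * / F z)); split; [|split].
  - apply jet_mult; apply jet_mult; auto using jet_const, jet_inv.
  - eapply near_imp; [|apply (near_and _ _ _ HF Hnz)].
    intros z [Hz Hz0]. etransitivity; [exact (inv_factor _ _ _ _ Ha Hz0 Hz)|ring].
  - ring.
Qed.

Lemma has_deriv_approx F a l : has_deriv F a l -> forall e, (0 < e)%R ->
  near a (fun z => (Cmod (F z - F a - (z - a) * l) <= e * Cmod (z - a))%R).
Proof.
  intros (K & HK & HF & <-) e He.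
  eapply near_imp; [|apply (near_and _ _ _ HF (jet1_continuous a K HK e He))].
  intros z [-> Hz].
  replace (F a + (z - a) * K z - F a - (z - a) * K a) with ((z - a) * (K z - K a)) by ring.
  rewrite Cmod_mult, Rmult_comm. apply Rmult_le_compat_r; [apply Cmod_ge_0|lra].
Qed.

(** Links the slopes with the library derivative, in terms of which the class is defined, so that
    uniqueness of the latter can identify the given [f']. *)
Lemma has_deriv_is_derive F a l : has_deriv F a l ->
  is_derive (K := C_AbsRing) (V := C_NormedModule) F a l.
Proof.
  intros H. split; [apply is_linear_scal_l|].
  intros x Hx.
  assert (x = a) as ->.
  { symmetry. apply (is_filter_lim_locally_unique (V := AbsRing_NormedModule C_AbsRing)). exact Hx. }
  intros [e He]. destruct (has_deriv_approx F a l H e He) as (d & Hd & Hn).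
  exists (mkposreal d Hd). intros z Hz. apply Hn. exact Hz.
Qed.

Lemma power_series_has_deriv c S : power_series c S ->
  exists c' S', power_series c' S' /\ forall a, inD a -> has_deriv S a (S' a).
Proof.
  intros HS. destruct (power_series_deriv c S HS) as (S' & HS' & H).
  exists (fun k => RtoC (INR (k + 1)) * c (k + 1)%nat), S'; split; [exact HS'|].
  intros a Ha. destruct (H a Ha) as (d & T & HT & HTa & Hf).
  exists T; split; [apply (smooth_power_series d T a HT Ha)|split; [|exact HTa]].
  eapply near_imp; [|apply (near_inD a Ha)]. exact Hf.
Qed.

(** * Maximum principle and mean value inequality *)

(** The increments [s, -s, i s, -i s] sum to 0, and so do their squares. The linear and quadratic
    terms of the jet cancel, leaving four cubic remainders; hence the factor 4 in the constant. *)
Lemma jet_four_point a F : jet 3 a F -> exists M d, (0 < d)%R /\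
  forall s, (0 < s < d)%R ->
  (Cmod (F (a + RtoC s)%C + F (a + - RtoC s)%C + F (a + Ci * RtoC s)%C
        + F (a + - (Ci * RtoC s))%C - 4 * F a)
    <= M * s ^ 3)%R.
Proof.
  intros (K1 & (K2 & (K3 & (M & HM) & H2) & H1) & H0).
  destruct (near_and _ _ _ H0 (near_and _ _ _ H1 (near_and _ _ _ H2 HM))) as (d & Hd & Hn).
  exists (4 * M)%R, d; split; [exact Hd|]. intros s Hs.
  assert (Hexp : forall w, Cmod w = s -> exists k, (Cmod k <= M)%R /\
     F (a + w) = F a + w * K1 a + w ^ 2 * K2 a + w ^ 3 * k).
  { intros w Hw.
    assert (Haw : a + w - a = w) by ring.
    destruct (Hn (a + w)) as (E0 & E1 & E2 & E3); [rewrite Haw; lra|].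
    exists (K3 (a + w)); split; [exact E3|].
    rewrite E0, E1, E2, Haw. ring. }
  assert (Hms : Cmod (RtoC s) = s) by (apply Cmod_RtoC_pos; lra).
  assert (Hmi : Cmod (Ci * RtoC s) = s) by (rewrite Cmod_mult, Cmod_Ci, Hms; ring).
  destruct (Hexp (RtoC s) Hms) as (k1 & B1 & ->).
  destruct (Hexp (- RtoC s)) as (k2 & B2 & ->); [rewrite Cmod_opp; exact Hms|].
  destruct (Hexp (Ci * RtoC s) Hmi) as (k3 & B3 & ->).
  destruct (Hexp (- (Ci * RtoC s))) as (k4 & B4 & ->); [rewrite Cmod_opp; exact Hmi|].
  assert (HCi : Ci * Ci = - (1)) by (unfold Ci, Cmult, Copp, RtoC; simpl; f_equal; ring).
  match goal with |- (Cmod ?x <= _)%R =>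
    replace x with (RtoC s ^ 3 * (k1 + - k2 + (- Ci * k3 + Ci * k4))) end.
  2: { simpl. ring_simplify. replace (Ci ^ 3) with (- Ci) by (transitivity (Ci * Ci * Ci); [rewrite HCi; ring|ring]).
       replace (Ci ^ 2) with (- (1)) by (rewrite <- HCi; ring). ring. }
  rewrite Cmod_mult, Cmod_pow, Hms, Rmult_comm.
  apply Rmult_le_compat_r; [apply pow_le; lra|].
  eapply Rle_trans; [apply Cmod_triangle|].
  eapply Rle_trans; [apply Rplus_le_compat; apply Cmod_triangle|].
  rewrite !Cmod_mult, !Cmod_opp, Cmod_Ci. lra.
Qed.

Lemma Cmod_coord_lt (x y u v d : R) : (Rabs (x - u) < d / 2)%R -> (Rabs (y - v) < d / 2)%R ->
  (Cmod ((x, y) - (u, v)) < d)%R.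
Proof.
  intros H1 H2.
  replace ((x, y) - (u, v)) with (RtoC (x - u) + Ci * RtoC (y - v)).
  2: { apply injective_projections; simpl; ring. }
  eapply Rle_lt_trans; [apply Cmod_triangle|].
  rewrite Cmod_mult, Cmod_Ci, !Cmod_R. lra.
Qed.

Lemma list_argmax {T : Type} (g : T -> R) (l : list T) : l <> nil ->
  exists t, In t l /\ forall s, In s l -> (g s <= g t)%R.
Proof.
  induction l as [|x l IH]; [congruence|intros _].
  destruct l as [|y l'].
  - exists x; split; [left; reflexivity|]. intros s [<-|[]]; lra.
  - destruct IH as (t & Ht & Hmax); [congruence|].
    destruct (Rle_dec (g t) (g x)) as [Hle|Hlt].
    + exists x; split; [left; reflexivity|].
      intros s [<-|Hs]; [lra|]. specialize (Hmax s Hs); lra.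
    + exists t; split; [right; exact Ht|].
      intros s [<-|Hs]; [lra|]. exact (Hmax s Hs).
Qed.

Lemma usc_max_attained (g : C -> R) (r : R) : (0 <= r)%R ->
  (forall a, (Cmod a <= r)%R -> forall e, (0 < e)%R -> near a (fun z => (g z < g a + e)%R)) ->
  exists a, (Cmod a <= r)%R /\ forall z, (Cmod z <= r)%R -> (g z <= g a)%R.
Proof.
  intros Hr Husc. apply NNPP; intros Hno.
  (* Each point [t] of the disc has a neighbourhood where [g < g (b t)], with [b t] in the disc;
     the largest of finitely many such values is then below itself. *)
  assert (Hex : forall t : C, exists bd : C * posreal, (Cmod (fst bd) <= r)%R /\
     forall z, (Cmod z <= r)%R -> (Cmod (z - t) < snd bd)%R -> (g z < g (fst bd))%R).
  { intros t. destruct (Rle_dec (Cmod t) r) as [Ht|Ht].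
    - assert (Hb : exists b, (Cmod b <= r)%R /\ (g t < g b)%R).
      { apply NNPP; intros Hnb. apply Hno. exists t; split; [exact Ht|].
        intros z Hz. apply Rnot_lt_le; intros Hlt. apply Hnb; exists z; auto. }
      destruct Hb as (b & Hb & Hgb).
      destruct (Husc t Ht (g b - g t)%R ltac:(lra)) as (d & Hd & Hn).
      exists (b, mkposreal d Hd); split; [exact Hb|]. intros z _ Hz.
      specialize (Hn z Hz). simpl in *. lra.
    (* The compactness argument covers a whole square. A point of it outside the disc gets a
       neighbourhood that misses the disc, with 0 as a default for [b t]. *)
    - assert (Hd : (0 < Cmod t - r)%R) by lra.
      exists (RtoC 0, mkposreal _ Hd); split; [simpl; rewrite Cmod_0; exact Hr|].
      simpl; intros z Hz Hzt. exfalso.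
      pose proof (Cmod_le_add t z) as H.
      replace (t - z) with (- (z - t)) in H by ring. rewrite Cmod_opp in H. lra. }
  destruct (functional_choice _ Hex) as [bd Hbd].
  set (pt := fun t : Compactness.Tn 2 R => (fst t, fst (snd t)) : C).
  (* The cover is by coordinate boxes; halving the radius keeps each box inside the corresponding
     round neighbourhood. *)
  set (half := fun t => mkposreal (snd (bd (pt t)) / 2)
         ltac:(generalize (cond_pos (snd (bd (pt t)))); lra)).
  apply (compactness_list 2 (-r, (-r, tt))%R (r, (r, tt)) half).
  intros [l Hl].
  assert (Hcov : forall z, (Cmod z <= r)%R -> exists t, In t l /\ (g z < g (fst (bd (pt t))))%R).
  { intros [x y] Hz.
    destruct (Hl (x, (y, tt))) as (t & Hin & _ & Hclose).
    { pose proof (Rmax_Cmod (x, y)) as Hm; simpl in Hm.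
      pose proof (Rmax_l (Rabs x) (Rabs y)); pose proof (Rmax_r (Rabs x) (Rabs y)).
      assert (H1 : (Rabs x <= r)%R) by lra. assert (H2 : (Rabs y <= r)%R) by lra.
      apply Rabs_le_between in H1, H2.
      simpl; repeat split; lra. }
    exists t; split; [exact Hin|].
    destruct (Hbd (pt t)) as [_ Hlt]. apply Hlt; [exact Hz|].
    unfold half in Hclose. destruct t as (u & v & w). destruct Hclose as (H1 & H2 & _).
    apply Cmod_coord_lt; assumption. }
  destruct (list_argmax (fun t => g (fst (bd (pt t)))) l) as (t & _ & Hmax).
  { intros ->. destruct (Hcov (RtoC 0)) as (t & [] & _). rewrite Cmod_0; exact Hr. }
  destruct (Hcov (fst (bd (pt t)))) as (s & Hs & Hlt); [apply Hbd|].
  specialize (Hmax s Hs). lra.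
Qed.

(** The mean of [|w|^2] over the four points exceeds the value at the centre by [s^2]; this
    quadratic gain outweighs the cubic error of [jet_four_point]. *)
Lemma Cmod_sqr_four_point (a : C) (s : R) :
  (Cmod (a + RtoC s) ^ 2 + Cmod (a + - RtoC s) ^ 2 + Cmod (a + Ci * RtoC s) ^ 2
    + Cmod (a + - (Ci * RtoC s)) ^ 2 = 4 * (Cmod a ^ 2 + s ^ 2))%R.
Proof. rewrite !Cmod2_alt. destruct a as [x y]; simpl. ring. Qed.

Lemma maximum_principle (F : C -> C) (r B : R) : (0 < r < 1)%R ->
  (forall a, inD a -> smooth a F) ->
  (forall z, Cmod z = r -> (Cmod (F z) <= B)%R) ->
  forall z, (Cmod z <= r)%R -> (Cmod (F z) <= B)%R.
Proof.
  intros Hr Hsm HB z Hz. apply le_epsilon; intros e He.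
  set (g := fun w => (Cmod (F w) + e * Cmod w ^ 2)%R).
  destruct (usc_max_attained g r ltac:(lra)) as (a & Ha & Hmax).
  { intros a Ha k Hk.
    assert (HaD : inD a) by (unfold inD; lra).
    (* As [|w|] and [|a|] are below 1, moving by [k'] raises [|w|^2] by at most [2 k'], and [g] by
       less than [k' + 2 e k' = k]. *)
    set (k' := (k / (1 + 2 * e))%R).
    assert (Hk' : (0 < k')%R) by (apply Rdiv_lt_0_compat; lra).
    eapply near_imp; [|apply (near_and _ _ _ (jet1_continuous a F (Hsm a HaD 1%nat) k' Hk')
       (near_and _ _ _ (near_ball a k' Hk') (near_inD a HaD)))].
    intros w (H1 & H2 & H3). unfold g.
    pose proof (Cmod_le_add (F w) (F a)). pose proof (Cmod_le_add w a).
    pose proof (Cmod_ge_0 w). pose proof (Cmod_ge_0 a). unfold inD in *.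
    assert (Hkk : (k = k' * (1 + 2 * e))%R) by (unfold k'; field; lra).
    assert (Cmod w ^ 2 <= Cmod a ^ 2 + 2 * k')%R by nra.
    assert (e * Cmod w ^ 2 <= e * (Cmod a ^ 2 + 2 * k'))%R by (apply Rmult_le_compat_l; lra).
    lra. }
  specialize (Hmax z Hz) as Hgz.
  (* At an interior maximum the four values of [g] sum to at most [4 g a], but the four-point
     formulas bound the sum below by [4 g a - M s^3 + 4 e s^2]. The choice of [s] gives [M s < 4 e],
     a contradiction. *)
  assert (Har : Cmod a = r).
  { destruct (Rle_lt_or_eq_dec _ _ Ha) as [Hlt|Heq]; [exfalso|exact Heq].
    destruct (jet_four_point a F (Hsm a ltac:(unfold inD; lra) 3%nat)) as (M & d & Hd & H4).
    set (s := (Rmin (d / 2) (Rmin (r - Cmod a) (e / (Rabs M + 1))))%R).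
    assert (HM : (0 < Rabs M + 1)%R) by (generalize (Rabs_pos M); lra).
    assert (HeM : (0 < e / (Rabs M + 1))%R) by (apply Rdiv_lt_0_compat; lra).
    assert (Hs0 : (0 < s)%R) by (repeat apply Rmin_glb_lt; lra).
    assert (Hs1 : (s <= d / 2)%R) by apply Rmin_l.
    assert (Hs2 : (s <= Rmin (r - Cmod a) (e / (Rabs M + 1)))%R) by apply Rmin_r.
    pose proof (Rmin_l (r - Cmod a) (e / (Rabs M + 1))).
    pose proof (Rmin_r (r - Cmod a) (e / (Rabs M + 1))).
    assert (Hs3 : (s * (Rabs M + 1) <= e)%R).
    { replace e with (e / (Rabs M + 1) * (Rabs M + 1))%R by (field; lra).
      apply Rmult_le_compat_r; lra. }
    specialize (H4 s ltac:(lra)).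
    assert (Hms : Cmod (RtoC s) = s) by (apply Cmod_RtoC_pos; lra).
    assert (Hmi : Cmod (Ci * RtoC s) = s) by (rewrite Cmod_mult, Cmod_Ci, Hms; ring).
    assert (Hg : forall w, Cmod w = s -> (g (a + w)%C <= g a)%R).
    { intros w Hw. apply Hmax. eapply Rle_trans; [apply Cmod_triangle|lra]. }
    pose proof (Hg (RtoC s) Hms) as G1.
    pose proof (Hg (- RtoC s) ltac:(rewrite Cmod_opp; exact Hms)) as G2.
    pose proof (Hg (Ci * RtoC s) Hmi) as G3.
    pose proof (Hg (- (Ci * RtoC s)) ltac:(rewrite Cmod_opp; exact Hmi)) as G4.
    pose proof (Cmod_sqr_four_point a s) as Hsq.
    unfold g in G1, G2, G3, G4.
    set (w1 := F (a + RtoC s)) in *. set (w2 := F (a + - RtoC s)) in *.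
    set (w3 := F (a + Ci * RtoC s)) in *. set (w4 := F (a + - (Ci * RtoC s))) in *.
    pose proof (Cmod_le_add (4 * F a) (w1 + w2 + w3 + w4)) as T0.
    replace (4 * F a - (w1 + w2 + w3 + w4)) with (- (w1 + w2 + w3 + w4 - 4 * F a)) in T0 by ring.
    rewrite Cmod_opp, Cmod_mult, Cmod_RtoC_pos in T0 by lra.
    pose proof (Cmod_triangle (w1 + w2 + w3) w4).
    pose proof (Cmod_triangle (w1 + w2) w3).
    pose proof (Cmod_triangle w1 w2).
    assert (HMs : (M * s ^ 3 < 4 * e * s ^ 2)%R).
    { assert (Hs2' : (0 < s ^ 2)%R) by (apply pow_lt; lra).
      assert (M * s < 4 * e)%R.
      { pose proof (Rle_abs M). assert (M * s <= Rabs M * s)%R by (apply Rmult_le_compat_r; lra). lra. }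
      replace (M * s ^ 3)%R with (M * s * s ^ 2)%R by ring.
      apply Rmult_lt_compat_r; lra. }
    apply Rmult_eq_compat_l with (r := e) in Hsq. lra. }
  unfold g in Hgz. rewrite Har in Hgz. specialize (HB a Har).
  assert (e * r ^ 2 <= e * 1)%R by (apply Rmult_le_compat_l; [lra|nra]).
  assert (0 <= e * Cmod z ^ 2)%R by (apply Rmult_le_pos; [lra|apply pow_le, Cmod_ge_0]).
  lra.
Qed.

Lemma Re_le_Cmod (z : C) : (Re z <= Cmod z)%R.
Proof. eapply Rle_trans; [apply Rle_abs|apply re_le_Cmod]. Qed.

(** The increment [u] is projected on its own direction: along the segment, [Re (conj u * F)] is a
    real function that grows by exactly [|u|^2]. The real mean value theorem bounds this by
    [|u| L |w - z|], and [|u|] cancels. *)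
Lemma deriv_bound_lipschitz (F F' : C -> C) (L : R) :
  (forall z, inD z -> has_deriv F z (F' z)) ->
  (forall z, inD z -> (Cmod (F' z) <= L)%R) ->
  forall z w, inD z -> inD w -> (Cmod (F w - F z) <= L * Cmod (w - z))%R.
Proof.
  intros HF HL z w Hz Hw.
  set (u := F w - F z). set (g := fun t : R => z + RtoC t * (w - z)).
  assert (Hg : forall t, (0 <= t <= 1)%R -> inD (g t)).
  { intros t Ht. unfold inD, g in *.
    replace (z + RtoC t * (w - z)) with (RtoC (1 - t) * z + RtoC t * w)
      by (rewrite RtoC_minus; ring).
    eapply Rle_lt_trans; [apply Cmod_triangle|].
    rewrite !Cmod_mult, !Cmod_RtoC_pos by lra.
    apply Rle_lt_trans with ((1 - t) * Rmax (Cmod z) (Cmod w) + t * Rmax (Cmod z) (Cmod w))%R.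
    - apply Rplus_le_compat; apply Rmult_le_compat_l; try lra; [apply Rmax_l|apply Rmax_r].
    - ring_simplify. apply Rmax_lub_lt; assumption. }
  destruct (Req_dec (Cmod u) 0) as [Hu0|Hu0].
  { rewrite Hu0. apply Rmult_le_pos; [|apply Cmod_ge_0].
    eapply Rle_trans; [apply Cmod_ge_0|apply (HL z Hz)]. }
  assert (Hu : (0 < Cmod u)%R) by (generalize (Cmod_ge_0 u); lra).
  set (phi := fun t : R => Re (Cconj u * F (g t))).
  set (dphi := fun t : R => Re (Cconj u * (F' (g t) * (w - z)))).
  assert (Hd : forall t, (0 <= t <= 1)%R -> derivable_pt_lim phi t (dphi t)).
  { intros t Ht e He.
    set (K := (Cmod u * Cmod (w - z) + 1)%R).
    assert (HK : (0 < K)%R).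
    { unfold K. generalize (Rmult_le_pos _ _ (Cmod_ge_0 u) (Cmod_ge_0 (w - z))). lra. }
    destruct (has_deriv_approx F (g t) _ (HF _ (Hg t Ht)) (e / K)%R
      ltac:(apply Rdiv_lt_0_compat; lra)) as (d & Hd & Hn).
    assert (Hd' : (0 < d / (Cmod (w - z) + 1))%R).
    { apply Rdiv_lt_0_compat; [exact Hd|]. generalize (Cmod_ge_0 (w - z)); lra. }
    exists (mkposreal _ Hd'). intros h Hh Hhd. simpl in Hhd.
    assert (Hgh : g (t + h)%R - g t = RtoC h * (w - z)) by (unfold g; rewrite RtoC_plus; ring).
    specialize (Hn (g (t + h)%R)). rewrite Hgh, Cmod_mult, Cmod_R in Hn.
    pose proof (Cmod_ge_0 (w - z)) as Hwz.
    assert (Hh0 : (0 < Rabs h)%R) by (apply Rabs_pos_lt, Hh).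
    assert (Hsmall : (Rabs h * Cmod (w - z) < d)%R).
    { apply Rmult_lt_compat_r with (r := (Cmod (w - z) + 1)%R) in Hhd; [|lra].
      replace (d / (Cmod (w - z) + 1) * (Cmod (w - z) + 1))%R with d in Hhd by (field; lra). lra. }
    specialize (Hn Hsmall).
    set (E := F (g (t + h)%R) - F (g t) - RtoC h * (w - z) * F' (g t)) in *.
    assert (Heq : ((phi (t + h) - phi t) / h - dphi t = Re (Cconj u * E) / h)%R).
    { unfold phi, dphi, E. destruct (F (g (t + h)%R)), (F (g t)), (F' (g t)), (w - z), u.
      simpl. field. exact Hh. }
    rewrite Heq. unfold Rdiv. rewrite Rabs_mult, Rabs_inv.
    apply Rmult_lt_reg_r with (Rabs h); [exact Hh0|].
    rewrite Rmult_assoc, Rinv_l, Rmult_1_r by lra.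
    eapply Rle_lt_trans; [apply re_le_Cmod|].
    rewrite Cmod_mult, Cmod_conj.
    apply Rle_lt_trans with (Cmod u * (e / K * (Rabs h * Cmod (w - z))))%R.
    { apply Rmult_le_compat_l; lra. }
    replace (Cmod u * (e / K * (Rabs h * Cmod (w - z))))%R
      with (e * Rabs h * (Cmod u * Cmod (w - z) / K))%R by (field; lra).
    rewrite <- (Rmult_1_r (e * Rabs h)) at 2.
    apply Rmult_lt_compat_l; [apply Rmult_lt_0_compat; lra|].
    apply Rmult_lt_reg_r with K; [exact HK|].
    unfold Rdiv; rewrite Rmult_assoc, Rinv_l by lra. unfold K; lra. }
  destruct (MVT_gen phi 0 1 dphi) as (c & Hc & Heq).
  - rewrite Rmin_left, Rmax_right by lra. intros t Ht. apply is_derive_Reals, Hd; lra.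
  - rewrite Rmin_left, Rmax_right by lra. intros t Ht. apply derivable_continuous_pt.
    exists (dphi t). apply Hd, Ht.
  - rewrite Rmin_left, Rmax_right in Hc by lra.
    assert (Hphi : (phi 1 - phi 0 = Cmod u ^ 2)%R).
    { rewrite Cmod2_alt. unfold phi.
      replace (g 1%R) with w by (unfold g; ring). replace (g 0%R) with z by (unfold g; ring).
      unfold u. destruct (F w), (F z); simpl; ring. }
    assert (Hbd : (dphi c <= Cmod u * (L * Cmod (w - z)))%R).
    { unfold dphi. eapply Rle_trans; [apply Re_le_Cmod|].
      rewrite !Cmod_mult, Cmod_conj. apply Rmult_le_compat_l; [lra|].
      apply Rmult_le_compat_r; [apply Cmod_ge_0|apply HL, Hg, Hc]. }
    apply Rmult_le_reg_l with (Cmod u); [exact Hu|].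
    rewrite Hphi in Heq. simpl in Heq. lra.
Qed.

(** * The rigidity argument *)

Definition analytic (S : C -> C) : Prop := exists c, power_series c S.

Lemma analytic_cons c S : analytic S -> analytic (fun z => z * S z + c).
Proof.
  intros [d HS]. exists (fun k => match k with O => c | Datatypes.S j => d j end).
  intros z Hz.
  replace (z * S z + c) with (z * S z + c * z ^ 0) by (simpl; ring).
  apply (cseries_cons (fun k => match k with O => c | Datatypes.S j => d j end * z ^ k)).
  eapply cseries_ext; [|apply cseries_scal, (HS z Hz)]. intros k; simpl; ring.
Qed.

Lemma analytic_plus S T : analytic S -> analytic T -> analytic (fun z => S z + T z).
Proof.
  intros [c HS] [d HT]. exists (fun k => c k + d k). intros z Hz.
  eapply cseries_ext; [|apply cseries_plus; [apply (HS z Hz)|apply (HT z Hz)]].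
  intros k; simpl; ring.
Qed.

Lemma analytic_scal x S : analytic S -> analytic (fun z => x * S z).
Proof.
  intros [c HS]. exists (fun k => x * c k). intros z Hz.
  eapply cseries_ext; [|apply cseries_scal, (HS z Hz)].
  intros k; simpl; ring.
Qed.

Lemma analytic_ext S T : (forall z, inD z -> S z = T z) -> analytic S -> analytic T.
Proof. intros H [c HS]. exists c; intros z Hz. rewrite <- (H z Hz). exact (HS z Hz). Qed.

Lemma analytic_const c : analytic (fun _ => c).
Proof.
  apply (analytic_ext (fun z => z * 0 + c)); [intros z _; ring|].
  apply (analytic_cons c (fun _ => 0)). exists (fun _ => 0). intros z _.
  apply (cseries_ext (fun _ => 0 * 0)); [intros n; ring|].
  destruct (geometric_cseries (fun _ => 0) 1 0 0) as (l & Hl & Hb); try lra.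
  - intros n. rewrite Cmod_0. lra.
  - rewrite Cmod_0; lra.
  - assert (l = 0) as ->.
    { apply Cmod_eq_0, Rle_antisym; [|apply Cmod_ge_0]. unfold Rdiv in Hb. lra. }
    eapply cseries_ext; [|exact Hl]. intros n; cbv beta; ring.
Qed.

(** All coefficients vanish. The sum is compared with the series of the constant 0, whose
    coefficients vanish by the same identity lemma. *)
Lemma analytic_zero_on_ray S (u : C) : analytic S -> Cmod u = 1%R ->
  (forall t, (0 < t < 1)%R -> S (RtoC t * u) = 0) -> forall z, inD z -> S z = 0.
Proof.
  intros [c HS] Hu H z Hz.
  pose proof (power_series_identity c S u HS Hu H) as Hc.
  destruct (analytic_const 0) as [d Hd].
  pose proof (power_series_identity d _ u Hd Hu ltac:(auto)) as Hd0.
  apply (cseries_unique (fun k => c k * z ^ k)); [apply HS, Hz|].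
  eapply cseries_ext; [|apply (Hd z Hz)]. intros k; cbv beta. rewrite Hc, Hd0. reflexivity.
Qed.

Lemma approximate_zero (lam : R) (al : C) (G : C -> C) : (0 < lam <= 1)%R ->
  Cmod al = (1 + lam)%R ->
  (forall z, inD z -> (Cmod (G z) <= lam * Cmod z)%R) ->
  (forall z w, inD z -> inD w -> (Cmod (G w - G z) <= lam * Cmod (w - z))%R) ->
  forall eta, (0 < eta)%R -> exists z, inD z /\ (Cmod (1 - al * z + z * G z) < eta)%R.
Proof.
  intros Hlam Hal HG HL eta Heta.
  (* In the final estimate the perturbation [ep * al * z] costs at most [2 ep <= eta / 4], and the
     fixed point defect at most [5 * eta / 10], where 5 bounds [|h|]. *)
  set (ep := Rmin 1 (eta / 8)).
  assert (Hep : (0 < ep)%R) by (apply Rmin_glb_lt; lra).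
  assert (Hep1 : (ep <= 1)%R) by apply Rmin_l.
  assert (Hep2 : (ep <= eta / 8)%R) by apply Rmin_r.
  set (h := fun z => RtoC (1 + ep) * al - G z).
  set (k := (/ (1 + ep))%R).
  assert (Hk : (0 < k < 1)%R).
  { unfold k; split; [apply Rinv_0_lt_compat; lra|].
    rewrite <- Rinv_1. apply Rinv_lt_contravar; lra. }
  assert (Hk1 : (k * (1 + ep) = 1)%R) by (unfold k; field; lra).
  assert (HGl : forall z, inD z -> (Cmod (G z) <= lam)%R).
  { intros z Hz. eapply Rle_trans; [apply HG, Hz|]. unfold inD in Hz. nra. }
  (* From below, [(1 + ep) (1 + lam) - lam >= 1 + ep]; from above, [2 * 2 + 1 = 5]. *)
  assert (Hh : forall z, inD z -> (1 + ep <= Cmod (h z) <= 5)%R).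
  { intros z Hz. pose proof (HGl z Hz) as HGz.
    pose proof (Cmod_le_add (RtoC (1 + ep) * al) (G z)) as H1.
    pose proof (Cmod_triangle (RtoC (1 + ep) * al) (- G z)) as H2.
    rewrite Cmod_opp in H2. fold (RtoC (1 + ep) * al - G z) in H2.
    rewrite Cmod_mult, Cmod_RtoC_pos, Hal in H1, H2 by lra.
    unfold h; split; nra. }
  assert (Hnz : forall z, inD z -> h z <> 0).
  { intros z Hz. apply Cmod_gt_0. specialize (Hh z Hz); lra. }
  assert (HT : forall z, inD z -> (Cmod (/ h z) <= k)%R).
  { intros z Hz. rewrite Cmod_inv by (apply Hnz, Hz). unfold k.
    apply Rinv_le_contravar; [lra|apply Hh, Hz]. }
  (* The difference of inverses is [(G w - G z) / (h w * h z)], so the Lipschitz constant is at most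
     [lam k^2 <= k]. *)
  assert (HTL : forall z w, inD z -> inD w -> (Cmod (/ h w - / h z) <= k * Cmod (w - z))%R).
  { intros z w Hz Hw.
    replace (/ h w - / h z) with ((G w - G z) * (/ h w * / h z)).
    2: { replace (G w - G z) with (h z - h w) by (unfold h; ring). field; auto. }
    rewrite !Cmod_mult.
    pose proof (HT z Hz). pose proof (HT w Hw). pose proof (HL z w Hz Hw).
    pose proof (Cmod_ge_0 (w - z)). pose proof (Cmod_ge_0 (/ h w)).
    pose proof (Cmod_ge_0 (/ h z)). pose proof (Cmod_ge_0 (G w - G z)).
    assert (Cmod (/ h w) * Cmod (/ h z) <= k * 1)%R by (apply Rmult_le_compat; lra).
    rewrite (Rmult_comm k). apply Rmult_le_compat; try lra; [apply Rmult_le_pos; lra|nra]. }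
  (* An approximate fixed point is enough, so the contraction is iterated only finitely often and no
     limit is taken. *)
  set (x := fun n => Nat.iter n (fun z => / h z) 0).
  assert (Hx : forall n, inD (x n)).
  { induction n as [|n IH]; simpl; unfold inD in *; [rewrite Cmod_0; lra|].
    specialize (HT _ IH). unfold x in *. lra. }
  assert (Hstep : forall n, (Cmod (/ h (x n) - x n) <= k ^ n)%R).
  { induction n as [|n IH].
    - simpl. replace (/ h 0 - 0) with (/ h 0) by ring.
      specialize (HT 0 (Hx 0%nat)). lra.
    - specialize (HTL (x n) (/ h (x n)) (Hx n) (Hx (S n))).
      change (x (S n)) with (/ h (x n)). simpl.
      eapply Rle_trans; [exact HTL|]. apply Rmult_le_compat_l; lra. }
  destruct (pow_lt_1_zero k ltac:(rewrite Rabs_pos_eq; lra) (eta / 10)%R ltac:(lra)) as [N HN].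
  specialize (HN N (le_n N)). rewrite Rabs_pos_eq in HN by (apply pow_le; lra).
  specialize (Hstep N). pose proof (Hx N) as HxN. set (z := x N) in *.
  exists z; split; [exact HxN|].
  replace (1 - al * z + z * G z) with (h z * (/ h z - z) + RtoC ep * (al * z)).
  2: { replace (h z * (/ h z - z)) with (1 - h z * z) by (field; apply Hnz, HxN).
       unfold h. rewrite RtoC_plus. ring. }
  eapply Rle_lt_trans; [apply Cmod_triangle|].
  rewrite !Cmod_mult, Cmod_RtoC_pos, Hal by lra.
  specialize (Hh z HxN). unfold inD in HxN.
  pose proof (Cmod_ge_0 (/ h z - z)). pose proof (Cmod_ge_0 z).
  assert (Cmod (h z) * Cmod (/ h z - z) <= 5 * k ^ N)%R by (apply Rmult_le_compat; lra).
  assert (ep * ((1 + lam) * Cmod z) <= eta / 8 * (2 * 1))%R.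
  { apply Rmult_le_compat; try lra; [apply Rmult_le_pos; lra|apply Rmult_le_compat; lra]. }
  lra.
Qed.

Lemma conj_unit (e : C) : Cmod e = 1%R -> e * Cconj e = 1.
Proof. intros H. rewrite <- Cmod2_conj, H. f_equal; ring. Qed.

(** Approximate zeros of [1 / p] must approach the unit circle, since [p] is bounded on smaller
    discs; near equality in the triangle inequality then pins down both [z] and [G z]. The Lipschitz
    bound carries the limiting value [lam e] back along the radius. *)
Lemma extremal_on_ray (lam : R) (e : C) (G p : C -> C) : (0 < lam <= 1)%R ->
  Cmod e = 1%R ->
  (forall z, inD z -> (Cmod (G z) <= lam * Cmod z)%R) ->
  (forall z w, inD z -> inD w -> (Cmod (G w - G z) <= lam * Cmod (w - z))%R) ->
  (forall z, inD z -> p z * (1 - RtoC (1 + lam) * e * z + z * G z) = 1) ->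
  (forall r, (0 <= r < 1)%R -> exists M, forall z, (Cmod z <= r)%R -> (Cmod (p z) <= M)%R) ->
  forall t, (0 < t < 1)%R -> G (RtoC t * Cconj e) = RtoC (lam * t) * e.
Proof.
  intros Hlam He HG HL Hp HM t Ht.
  pose proof (conj_unit e He) as Hee.
  assert (Hec : Cmod (Cconj e) = 1%R) by (rewrite Cmod_conj; exact He).
  assert (Hal : Cmod (RtoC (1 + lam) * e) = (1 + lam)%R).
  { rewrite Cmod_mult, He, Cmod_RtoC_pos by lra; ring. }
  assert (Hlim : forall ka, (0 < ka)%R -> exists z, inD z /\
     (Cmod (G z - RtoC lam * e) <= ka)%R /\ (Cmod (z - Cconj e) <= ka)%R).
  { intros ka Hka.
    (* The bound 1/2 gives [(1 - eta) (1 + 4 eta) >= 1 + eta], hence [Re y >= lam - 4 eta]. With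
       [|y| <= lam] this yields [|y - lam|^2 <= 8 eta], and [ka^2 / 32] makes the right side at most
       [(ka / 2)^2]. The remaining [ka / 2] pays for [g]. *)
    set (eta := Rmin (1 / 2) (Rmin (ka / 2) (ka ^ 2 / 32))).
    assert (Hk2 : (0 < ka ^ 2)%R) by (apply pow_lt; lra).
    assert (Heta : (0 < eta)%R) by (repeat apply Rmin_glb_lt; lra).
    assert (He1 : (eta <= 1 / 2)%R) by apply Rmin_l.
    assert (He2 : (eta <= Rmin (ka / 2) (ka ^ 2 / 32))%R) by apply Rmin_r.
    pose proof (Rmin_l (ka / 2) (ka ^ 2 / 32)). pose proof (Rmin_r (ka / 2) (ka ^ 2 / 32)).
    destruct (HM (1 - eta)%R ltac:(lra)) as [M HMr].
    assert (HM1 : (0 < Rabs M + 1)%R) by (generalize (Rabs_pos M); lra).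
    assert (HiM : (0 < / (Rabs M + 1))%R) by (apply Rinv_0_lt_compat, HM1).
    destruct (approximate_zero lam _ G Hlam Hal HG HL (Rmin eta (/ (Rabs M + 1)))
      ltac:(apply Rmin_glb_lt; lra)) as (z & Hz & Hg).
    specialize (Hp z Hz). specialize (HG z Hz).
    set (g := 1 - RtoC (1 + lam) * e * z + z * G z) in *.
    assert (Hg1 : (Cmod g < eta)%R) by (eapply Rlt_le_trans; [exact Hg|apply Rmin_l]).
    assert (Hg2 : (Cmod g < / (Rabs M + 1))%R) by (eapply Rlt_le_trans; [exact Hg|apply Rmin_r]).
    (* On the disc of radius [1 - eta] one has [|p| <= M], so [p z * g = 1] is impossible there with
       [|g| < 1 / (|M| + 1)]. *)
    assert (Hzr : (1 - eta < Cmod z)%R).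
    { apply Rnot_le_lt; intros Hle. specialize (HMr z Hle).
      assert (H1 : (Cmod (p z) * Cmod g = 1)%R) by (rewrite <- Cmod_mult, Hp; apply Cmod_1).
      assert (H2 : (Cmod (p z) * Cmod g <= Rabs M * / (Rabs M + 1))%R).
      { pose proof (Rle_abs M). apply Rmult_le_compat; try apply Cmod_ge_0; lra. }
      assert (H3 : ((Rabs M + 1) * / (Rabs M + 1) = 1)%R) by (apply Rinv_r; lra).
      lra. }
    unfold inD in Hz.
    (* In the rotated coordinates [y = G z * ebar], [zeta = z * e] we have
       [zeta (1 + lam - y) = 1 - g] and [|y| <= lam], which forces [y] to be near [lam]. *)
    set (y := G z * Cconj e). set (zeta := z * e).
    assert (Hzeta : Cmod zeta = Cmod z) by (unfold zeta; rewrite Cmod_mult, He; ring).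
    assert (Hy : (Cmod y <= lam)%R).
    { unfold y. rewrite Cmod_mult, Hec. nra. }
    assert (Hrel : zeta * (RtoC (1 + lam) - y) = 1 - g).
    { unfold zeta, y, g.
      replace (z * e * (RtoC (1 + lam) - G z * Cconj e))
        with (z * e * RtoC (1 + lam) - z * G z * (e * Cconj e)) by ring.
      rewrite Hee; ring. }
    assert (Hh : (Cmod (RtoC (1 + lam) - y) <= 1 + 4 * eta)%R).
    { assert (H1 : (Cmod z * Cmod (RtoC (1 + lam) - y) <= 1 + eta)%R).
      { rewrite <- Hzeta, <- Cmod_mult, Hrel.
        eapply Rle_trans; [apply Cmod_triangle|]. rewrite Cmod_opp, Cmod_1. lra. }
      apply Rnot_lt_le; intros Hlt.
      assert ((1 - eta) * (1 + 4 * eta) < Cmod z * Cmod (RtoC (1 + lam) - y))%R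
        by (apply Rmult_gt_0_lt_compat; lra).
      nra. }
    assert (Hre : (lam - 4 * eta <= Re y)%R).
    { pose proof (Rle_trans _ _ _ (Rle_abs _) (re_le_Cmod (RtoC (1 + lam) - y))) as H1.
      destruct y as [y1 y2]; simpl in *. lra. }
    assert (Hyl : (Cmod (y - RtoC lam) <= ka / 2)%R).
    { apply Rsqr_incr_0_var; [|lra]. rewrite !Rsqr_pow2.
      assert (Hy2 : (Cmod y ^ 2 <= lam ^ 2)%R) by (apply pow_incr; split; [apply Cmod_ge_0|exact Hy]).
      rewrite Cmod2_alt in *. destruct y as [y1 y2]; simpl in *. nra. }
    exists z; split; [exact Hz|split].
    - replace (G z - RtoC lam * e) with ((y - RtoC lam) * e).
      2: { unfold y. transitivity (G z * (e * Cconj e) - RtoC lam * e); [ring|rewrite Hee; ring]. }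
      rewrite Cmod_mult, He. lra.
    - replace (z - Cconj e) with ((- g + zeta * (y - RtoC lam)) * Cconj e).
      2: { replace (- g + zeta * (y - RtoC lam)) with (zeta - 1).
           - unfold zeta. transitivity (z * (e * Cconj e) - Cconj e); [ring|rewrite Hee; ring].
           - replace (- g) with (1 - g - 1) by ring. rewrite <- Hrel, RtoC_plus. ring. }
      rewrite Cmod_mult, Hec, Rmult_1_r.
      eapply Rle_trans; [apply Cmod_triangle|]. rewrite Cmod_opp, Cmod_mult, Hzeta.
      pose proof (Cmod_ge_0 (y - RtoC lam)). pose proof (Cmod_ge_0 z). nra. }
  set (x := RtoC t * Cconj e).
  assert (Hxm : Cmod x = t) by (unfold x; rewrite Cmod_mult, Hec, Cmod_RtoC_pos; lra).
  assert (Hx : inD x) by (unfold inD; lra).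
  assert (H1 : (Cmod (G x) <= lam * t)%R) by (rewrite <- Hxm; apply HG, Hx).
  (* A point [z] within [ep / 2] of [Cconj e] lies within [1 - t + ep / 2] of [x]; since [lam <= 1],
     the two errors add up to at most [ep]. *)
  assert (H2 : (Cmod (G x - RtoC lam * e) <= lam * (1 - t))%R).
  { apply le_epsilon; intros ep Hep.
    destruct (Hlim (ep / 2)%R ltac:(lra)) as (z & Hz & Hz1 & Hz2).
    assert (Hxz : (Cmod (x - z) <= (1 - t) + ep / 2)%R).
    { replace (x - z) with (RtoC (- (1 - t)) * Cconj e + - (z - Cconj e)).
      2: { unfold x. rewrite RtoC_opp, RtoC_minus. ring. }
      eapply Rle_trans; [apply Cmod_triangle|].
      rewrite Cmod_opp, Cmod_mult, Hec, Cmod_R, Rabs_Ropp, Rabs_pos_eq by lra. lra. }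
    pose proof (HL z x Hz Hx) as Hl.
    replace (G x - RtoC lam * e) with ((G x - G z) + (G z - RtoC lam * e)) by ring.
    eapply Rle_trans; [apply Cmod_triangle|]. nra. }
  set (y := G x * Cconj e).
  assert (Hy1 : (Cmod y <= lam * t)%R) by (unfold y; rewrite Cmod_mult, Hec; lra).
  assert (Hy2 : (Cmod (RtoC lam - y) <= lam * (1 - t))%R).
  { replace (RtoC lam - y) with (- (G x - RtoC lam * e) * Cconj e).
    2: { unfold y. transitivity (RtoC lam * (e * Cconj e) - G x * Cconj e); [ring|rewrite Hee; ring]. }
    rewrite Cmod_mult, Cmod_opp, Hec. lra. }
  (* The discs of radius [lam t] about 0 and [lam (1 - t)] about [lam] are externally tangent and
     meet only at [lam t]: the real part is forced first, then the imaginary part vanishes. *)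
  assert (Hy : y = RtoC (lam * t)).
  { pose proof (Rle_trans _ _ _ (Rle_abs _) (re_le_Cmod (RtoC lam - y))) as H3.
    assert (Hlt : (0 < lam * t)%R) by (apply Rmult_lt_0_compat; lra).
    assert (Hy3 : (Cmod y ^ 2 <= (lam * t) ^ 2)%R).
    { apply pow_incr; split; [apply Cmod_ge_0|exact Hy1]. }
    pose proof (Rle_trans _ _ _ (Rle_abs _) (re_le_Cmod y)) as H4.
    rewrite Cmod2_alt in Hy3. destruct y as [y1 y2]; simpl in *.
    assert (y1 = lam * t)%R as -> by lra.
    assert (y2 * y2 = 0)%R by nra.
    apply injective_projections; simpl; [reflexivity|nra]. }
  rewrite <- Hy. unfold y. transitivity (G x * (e * Cconj e)); [rewrite Hee; ring|ring].
Qed.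

(** * Arguments of unit complex numbers and reduction of the class U(lambda) *)

Lemma unit_cis (e : C) : Cmod e = 1%R -> exists phi, cis phi = e.
Proof.
  intros He. pose proof (Cmod2_alt e) as H. rewrite He in H. destruct e as [x y]; simpl in H.
  assert (Hx : (-1 <= x <= 1)%R) by nra.
  assert (Hs : (1 - x²)%R = (y²)%R) by (unfold Rsqr; lra).
  destruct (Rle_dec 0 y) as [Hy|Hy].
  - exists (acos x). unfold cis. rewrite cos_acos, sin_acos, Hs, sqrt_Rsqr by lra. reflexivity.
  - exists (- acos x)%R. unfold cis.
    rewrite cos_neg, sin_neg, cos_acos, sin_acos, Hs, Rsqr_neg, sqrt_Rsqr by lra.
    f_equal; ring.
Qed.

Lemma cis_double (phi : R) : cis (2 * phi) = cis phi ^ 2.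
Proof.
  unfold cis. rewrite cos_2a, sin_2a.
  apply injective_projections; simpl; ring.
Qed.

Lemma pseries_power_series (f : C -> C) (a : nat -> C) :
  (forall z, inD z -> is_pseries (K := C_AbsRing) (V := C_NormedModule) a z (f z)) ->
  power_series a f.
Proof.
  intros H z Hz. eapply cseries_ext; [|exact (H z Hz)].
  intros k. cbv beta. change scal with Cmult.
  replace (pow_n (K := C_AbsRing) z k) with (z ^ k); [ring|].
  induction k as [|k IH]; simpl; [reflexivity|]. rewrite IH. reflexivity.
Qed.

(** Separating the first two coefficients makes the expansion [1 / p = 1 - a2 z + O(z^2)] explicit,
    with a single analytic function [s] as remainder. *)
Lemma classA_tail (f : C -> C) (a : nat -> C) : classA f a ->
  exists c s, power_series c s /\
  forall z, inD z -> f z = z * (1 + (a 2%nat * z + z * z * s z)).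
Proof.
  intros (Ha0 & Ha1 & Hf). apply pseries_power_series in Hf.
  assert (Hsub : subexp (fun k => a (S (S (S k))))).
  { do 3 apply (subexp_shift (fun k => a _)). exact (power_series_subexp _ _ Hf). }
  destruct (subexp_power_series _ Hsub) as [s Hs].
  exists (fun k => a (S (S (S k)))), s; split; [exact Hs|].
  intros z Hz.
  assert (H3 : cseries (fun k => a (S (S (S k))) * z ^ S (S (S k))) (z ^ 3 * s z)).
  { eapply cseries_ext; [|apply cseries_scal, (Hs z Hz)]. intros k; simpl; ring. }
  apply (cseries_cons (fun k => a (S (S k)) * z ^ S (S k))) in H3.
  apply (cseries_cons (fun k => a (S k) * z ^ S k)) in H3.
  apply (cseries_cons (fun k => a k * z ^ k)) in H3.
  rewrite (cseries_unique _ _ _ (Hf z Hz) H3), Ha0, Ha1. simpl. ring.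
Qed.

(** The limit [r -> 1], made explicit with [r = 1 - d]: as [(1 - d)^2 >= 1 - 2 d], the loss is at
    most [2 x d <= e]. *)
Lemma scaled_bound_limit (x y r0 : R) : (0 <= x)%R -> (r0 < 1)%R ->
  (forall r, (r0 < r < 1)%R -> (0 < r)%R -> (x * r ^ 2 <= y)%R) -> (x <= y)%R.
Proof.
  intros Hx Hr H. apply le_epsilon; intros e He.
  set (d := Rmin (1 / 2) (Rmin ((1 - r0) / 2) (e / (2 * (x + 1))))).
  assert (He' : (0 < e / (2 * (x + 1)))%R) by (apply Rdiv_lt_0_compat; lra).
  assert (Hd : (0 < d)%R) by (repeat apply Rmin_glb_lt; lra).
  assert (H1 : (d <= 1 / 2)%R) by apply Rmin_l.
  assert (H2 : (d <= Rmin ((1 - r0) / 2) (e / (2 * (x + 1))))%R) by apply Rmin_r.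
  pose proof (Rmin_l ((1 - r0) / 2) (e / (2 * (x + 1)))) as Hm1.
  pose proof (Rmin_r ((1 - r0) / 2) (e / (2 * (x + 1)))) as Hm2.
  specialize (H (1 - d)%R ltac:(lra) ltac:(lra)).
  assert (H3 : (2 * (x + 1) * d <= e)%R).
  { replace e with (2 * (x + 1) * (e / (2 * (x + 1))))%R by (field; lra).
    apply Rmult_le_compat_l; lra. }
  nra.
Qed.

(** The Schwarz lemma argument for a double zero at 0: [|F| <= L / r^2] on the circle of radius [r],
    hence inside it by the maximum principle, and then [r] tends to 1. *)
Lemma bound_up_to_boundary (F : C -> C) (L : R) :
  (forall a, inD a -> smooth a F) ->
  (forall z, inD z -> z <> 0 -> (Cmod (z ^ 2 * F z) <= L)%R) ->
  forall z, inD z -> (Cmod (F z) <= L)%R.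
Proof.
  intros Hsm HF z Hz.
  apply (scaled_bound_limit _ _ (Cmod z)); [apply Cmod_ge_0|exact Hz|].
  intros r Hr Hr0.
  assert (Hr2 : (0 < r ^ 2)%R) by (apply pow_lt, Hr0).
  assert (H : (Cmod (F z) <= L / r ^ 2)%R).
  { apply (maximum_principle F r); [lra|exact Hsm| |lra].
    intros w Hw. specialize (HF w ltac:(unfold inD; lra) ltac:(apply Cmod_gt_0; lra)).
    rewrite Cmod_mult, Cmod_pow, Hw in HF.
    apply Rmult_le_reg_l with (r ^ 2)%R; [exact Hr2|].
    unfold Rdiv. rewrite (Rmult_comm L), <- Rmult_assoc, Rinv_r by lra. lra. }
  apply Rmult_le_compat_r with (r := (r ^ 2)%R) in H; [|lra].
  unfold Rdiv in H. rewrite Rmult_assoc, Rinv_l in H by lra. lra.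
Qed.

(* Here [G = N / p = 1/f - 1/z + a2], and [G' = - q / p^2 = - U_f / z^2]. *)
Lemma classU_structure (lam : R) (f : C -> C) (a : nat -> C) : (0 < lam)%R ->
  classU lam f a -> exists p G,
  analytic p /\
  (forall z, inD z -> f z = z * p z) /\
  (forall z, inD z -> p z * (1 - a 2%nat * z + z * G z) = 1) /\
  G 0 = 0 /\
  (forall z w, inD z -> inD w -> (Cmod (G w - G z) <= lam * Cmod (w - z))%R).
Proof.
  intros Hlam (HA & Hnz & f' & Hf' & HU).
  destruct (classA_tail f a HA) as (c & s & Hs & Hf).
  destruct (power_series_has_deriv c s Hs) as (c1 & s1 & Hs1 & Hds).
  set (b := a 2%nat) in *.
  set (p := fun z => 1 + (b * z + z * z * s z)) in *.
  (* [N] solves [p (1 - b z) + z N = 1], and [q] solves [z^2 q = p + z p' - p^2], the numerator of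
     [U_f]. Both divisions by powers of [z] are carried out explicitly, so the formulas make sense
     at 0. *)
  set (N := fun z => z * (b * b + (- (1) * s z + b * z * s z))).
  set (q := fun z => s z + (z * s1 z + (- (b * b) + (- (2) * b * z * s z + - (1) * (z * z * (s z * s z)))))).
  assert (Hp0 : forall z, inD z -> p z <> 0).
  { intros z Hz. destruct (Ceq_dec z 0) as [->|Hz0].
    - replace (p 0) with (RtoC 1) by (unfold p; ring). apply C1_nz.
    - intros E. apply (Hnz z Hz Hz0). rewrite (Hf z Hz). fold (p z). rewrite E; ring. }
  assert (Hdp : forall z, inD z -> has_deriv p z (b + (2 * z * s z + z * z * s1 z))).
  { intros z Hz. unfold p. eapply has_deriv_value; [|
      repeat first [apply has_deriv_const | apply has_deriv_id | apply (Hds z Hz)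
        | apply has_deriv_plus | apply has_deriv_mult]].
    cbv beta; ring. }
  assert (HdN : forall z, inD z ->
    has_deriv N z (b * b - s z - z * s1 z + 2 * b * z * s z + b * z * z * s1 z)).
  { intros z Hz. unfold N. eapply has_deriv_value; [|
      repeat first [apply has_deriv_const | apply has_deriv_id | apply (Hds z Hz)
        | apply has_deriv_plus | apply has_deriv_mult]].
    cbv beta; ring. }
  assert (HdG : forall z, inD z ->
    has_deriv (fun z => N z * / p z) z (- (1) * (q z * (/ p z * / p z)))).
  { intros z Hz. eapply has_deriv_value;
      [|apply has_deriv_mult; [apply HdN, Hz|apply has_deriv_inv; [apply Hp0, Hz|apply Hdp, Hz]]].
    pose proof (Hp0 z Hz) as Hpz.
    (* The numerator [N' p - N p'] of the quotient rule is exactly [- q]. *)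
    replace (q z) with (- ((b * b - s z - z * s1 z + 2 * b * z * s z + b * z * z * s1 z) * p z
       - N z * (b + (2 * z * s z + z * z * s1 z)))) by (unfold q, p, N; ring).
    field. exact Hpz. }
  (* The given [f'] is some derivative of [f]; by uniqueness it is the one obtained from the product
     rule for [z p]. *)
  assert (Hf1 : forall z, inD z -> f' z = p z + z * (b + (2 * z * s z + z * z * s1 z))).
  { intros z Hz. rewrite <- (is_C_derive_unique _ _ _ (Hf' z Hz)).
    apply is_C_derive_unique, has_deriv_is_derive.
    apply (has_deriv_ext (fun z => z * p z)).
    - eapply near_imp; [|apply (near_inD z Hz)]. intros w Hw; symmetry; apply Hf, Hw.
    - eapply has_deriv_value; [|apply has_deriv_mult; [apply has_deriv_id|apply Hdp, Hz]]. cbv beta; ring. }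
  assert (HUf : forall z, inD z -> z <> 0 -> U_f f f' z = z ^ 2 * (q z * (/ p z * / p z))).
  { intros z Hz Hz0. pose proof (Hp0 z Hz) as Hpz.
    unfold U_f. rewrite (Hf1 z Hz), (Hf z Hz). fold (p z).
    replace (z ^ 2 * (q z * (/ p z * / p z)))
      with ((z ^ 2 * q z) * (/ p z * / p z)) by ring.
    replace (z ^ 2 * q z) with (p z + z * (b + (2 * z * s z + z * z * s1 z)) - p z * p z)
      by (unfold q, p; ring).
    field; auto. }
  assert (Hbound : forall z, inD z -> (Cmod (q z * (/ p z * / p z)) <= lam)%R).
  { apply bound_up_to_boundary.
    - intros z Hz.
      pose proof (smooth_power_series _ _ z Hs Hz). pose proof (smooth_power_series _ _ z Hs1 Hz).
      assert (smooth z p) by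
       (unfold p; repeat first [assumption | apply smooth_const | apply smooth_id
                             | apply smooth_plus | apply smooth_mult]).
      assert (smooth z (fun z => / p z)) by (apply smooth_inv; [apply Hp0, Hz|assumption]).
      unfold q; repeat first [assumption | apply smooth_const | apply smooth_id
                             | apply smooth_plus | apply smooth_mult].
    - intros z Hz Hz0. rewrite <- HUf by assumption. left; apply HU; assumption. }
  exists p, (fun z => N z * / p z). repeat split.
  - apply (analytic_ext (fun z => z * (z * s z + b) + 1)); [intros z _; unfold p; ring|].
    apply analytic_cons, analytic_cons. exists c; exact Hs.
  - exact Hf.
  - intros z Hz. pose proof (Hp0 z Hz) as Hpz.
    transitivity (p z * (1 - b * z) + z * N z * (p z * / p z)); [ring|].
    replace (p z * / p z) with (RtoC 1) by (field; exact Hpz).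
    unfold p, N. ring.
  - unfold N. ring.
  - apply (deriv_bound_lipschitz _ _ lam HdG).
    intros z Hz. rewrite Cmod_mult, Cmod_opp, Cmod_1, Rmult_1_l. apply Hbound, Hz.
Qed.

Theorem theorem2p2 (lam : R) (f : C -> C) (a : nat -> C) :
  (0 < lam <= 1)%R ->
  classU lam f a ->
  Cmod (a 2%nat) = (1 + lam)%R ->
  (exists theta : R, forall z, inD z ->
     f z = z / (1 - a 2%nat * z + RtoC lam * cis theta * z ^ 2)) /\
  (exists phi : R, forall z, inD z ->
     f z = z / (1 - RtoC (1 + lam) * cis phi * z + RtoC lam * cis (2 * phi) * z ^ 2)).
Proof.
  intros Hlam Hf Ha.
  destruct (classU_structure lam f a ltac:(lra) Hf) as (p & G & Hp & Hfp & HpG & HG0 & HL).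
  assert (Hl0 : RtoC (1 + lam) <> 0) by (apply Cmod_gt_0; rewrite Cmod_RtoC_pos; lra).
  destruct (unit_cis (a 2%nat / RtoC (1 + lam))) as [phi Hphi].
  { rewrite Cmod_div, Ha, Cmod_RtoC_pos by (try exact Hl0; lra). field; lra. }
  assert (He : Cmod (cis phi) = 1%R).
  { rewrite Hphi, Cmod_div, Ha, Cmod_RtoC_pos by (try exact Hl0; lra). field; lra. }
  assert (Ha2 : a 2%nat = RtoC (1 + lam) * cis phi) by (rewrite Hphi; field; exact Hl0).
  rewrite Ha2 in *. set (e := cis phi) in *.
  assert (HG : forall z, inD z -> (Cmod (G z) <= lam * Cmod z)%R).
  { intros z Hz. specialize (HL 0 z ltac:(unfold inD; rewrite Cmod_0; lra) Hz).
    rewrite HG0 in HL. replace (G z - 0) with (G z) in HL by ring.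
    replace (z - 0) with z in HL by ring. exact HL. }
  pose proof (extremal_on_ray lam e G p Hlam He HG HL HpG
    ltac:(destruct Hp as [c Hc]; intros r Hr; exact (power_series_bounded c p r Hc Hr))) as Hray.
  pose proof (conj_unit e He) as Hee.
  assert (Hec : Cmod (Cconj e) = 1%R) by (rewrite Cmod_conj; exact He).
  set (Q := fun z => 1 - RtoC (1 + lam) * e * z + RtoC lam * e ^ 2 * z ^ 2).
  assert (HQ : forall z, inD z -> p z * Q z = 1).
  { intros z Hz.
    replace (p z * Q z) with ((p z * Q z - 1) + 1) by ring.
    enough (E : p z * Q z - 1 = 0) by (rewrite E; ring).
    (* As [p Q - 1] is analytic, one radius is enough. On the one through [Cconj e] the value of [G]
       is [lam e^2 x], and the relation between [p] and [G] becomes [p Q = 1]. *)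
    revert z Hz. apply (analytic_zero_on_ray _ (Cconj e)); [|exact Hec|].
    - apply (analytic_ext (fun z => (z * (- (RtoC (1 + lam) * e) * p z +
         (z * (RtoC lam * e ^ 2 * p z) + 0)) + - (1)) + p z)); [intros z _; unfold Q; ring|].
      apply analytic_plus; [|exact Hp].
      apply (analytic_cons _ (fun z => - (RtoC (1 + lam) * e) * p z + (z * (RtoC lam * e ^ 2 * p z) + 0))).
      apply analytic_plus; [apply analytic_scal, Hp|].
      apply (analytic_cons _ (fun z => RtoC lam * e ^ 2 * p z)), analytic_scal, Hp.
    - intros t Ht. set (x := RtoC t * Cconj e).
      assert (Hx : inD x).
      { unfold inD, x. rewrite Cmod_mult, Hec, Cmod_RtoC_pos; lra. }
      (* The sixth occurrence of [x] is the argument of [G]; unfolding it alone exposes the form to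
         which the ray identity applies. *)
      rewrite <- (HpG x Hx). unfold x at 6. rewrite (Hray t Ht). fold x.
      unfold Q.
      assert (Hxe : e * x = RtoC t).
      { unfold x. transitivity (RtoC t * (e * Cconj e)); [ring|rewrite Hee; ring]. }
      rewrite RtoC_mult, <- Hxe. ring. }
  assert (Hfinal : forall z, inD z ->
    f z = z / (1 - RtoC (1 + lam) * e * z + RtoC lam * cis (2 * phi) * z ^ 2)).
  { intros z Hz. rewrite cis_double. fold e. fold (Q z). specialize (HQ z Hz).
    assert (HQz : Q z <> 0).
    { intros E. rewrite E in HQ. apply C1_nz. rewrite <- HQ. ring. }
    rewrite (Hfp z Hz). transitivity (z * (p z * Q z) / Q z); [field; exact HQz|].
    rewrite HQ. field; exact HQz. }
  split; [exists (2 * phi)%R|exists phi]; exact Hfinal.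
Qed.
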